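(* Let $F$ be a field of arbitrary characteristic. Let $\Gamma=\Gamma_0\oplus\Gamma_1$ be a $\Gamma$-algebra over $F$. Then the $\Gamma$-envelope $\Gamma(B(4,2))=\Gamma_0\otimes M_2(F)+\Gamma_1\otimes \mathrm{Cay}$ is isomorphic, as an $F$-algebra, to the algebra $M_2(\Gamma_0)\oplus\Gamma_1^{2}$ defined in the context. In particular, an $F$-algebra $A$ is an alternative $M_2$-algebra if and only if $A\cong\Gamma(B(4,2))$ for a certain $\Gamma$-algebra $\Gamma$.
   Context: Algebras are not assumed associative; $[a,b]=ab-ba$, $(a,b,c)=(ab)c-a(bc)$, and $Z(\cdot)$ denotes the center. A $\Gamma$-algebra is a $\mathbb Z_2$-graded $F$-algebra $\Gamma=\Gamma_0\oplus\Gamma_1$ such that: (i) $\Gamma_0$ is a unital associative algebra whose identity is the identity of $\Gamma$, $[\Gamma_0,\Gamma_1]=0$ and $(\Gamma_0,\Gamma,\Gamma)=0$ (associators whose first entry is in $\Gamma_0$ vanish); (ii) $\Gamma_1^2\subseteq Z(\Gamma_0)$; (iii) $xy+yx=0$ and $x^2=0$ for $x,y\in\Gamma_1$; (iv) $(xy)z+(yz)x+(zx)y=0$ for $x,y,z\in\Gamma_1$. $B(4,2)=M_2(F)\oplus\mathrm{Cay}$ is the $\mathbb Z_2$-graded algebra with even part $M_2(F)$ (usual product, matrix units $e_{ij}$), odd part $\mathrm{Cay}=Fm_1+Fm_2$, with products $e_{ij}\cdot m_k=\delta_{ik}m_j$ and $m\cdot a=\bar a\cdot m$ for $a\in M_2(F)$,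 $m\in \mathrm{Cay}$, where $a\mapsto\bar a$ is the symplectic involution $\overline{\begin{pmatrix}a&b\\c&d\end{pmatrix}}=\begin{pmatrix}d&-b\\-c&a\end{pmatrix}$, and $m_1^2=e_{21}$, $m_2^2=-e_{12}$, $m_1m_2=-e_{11}$, $m_2m_1=e_{22}$. (It is used here in any characteristic, although it is an alternative superalgebra only in characteristic 3.) The $\Gamma$-envelope $\Gamma_0\otimes M_2(F)+\Gamma_1\otimes\mathrm{Cay}$ has product $(\gamma\otimes b)(\gamma'\otimes b')=\gamma\gamma'\otimes bb'$. The algebra $M_2(\Gamma_0)\oplus\Gamma_1^2$: write $\langle u,v\rangle=uv\in\Gamma_0$ for $u,v\in\Gamma_1$. For $X=X_a+(x,y)$, $Y=Y_a+(z,t)$ with $X_a,Y_a\in M_2(\Gamma_0)$ and $(x,y),(z,t)\in\Gamma_1^2$, $$XY=X_aY_a+\begin{pmatrix}-\langle x,t\rangle&-\langle y,t\rangle\\ \langle x,z\rangle&\langle y,z\rangle\end{pmatrix}+(z,t)X_a+(x,y)(Y_a)^*,$$ where $\begin{pmatrix}a&b\\c&d\end{pmatrix}^*=\begin{pmatrix}d&-b\\-c&a\end{pmatrix}$ and a pair (row vector) is multiplied by a matrix over $\Gamma_0$ in the usual way. An (alternative) $M_2$-algebra is a unital alternative $F$-algebra $A$ for which there exists a homomorphism of unital algebras $M_2(F)\to A$. *)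

(* Defs.v *)
From HB Require Import structures.
From mathcomp Require Import all_boot all_order all_algebra.
From mathcomp Require Import boolp.

Set Implicit Arguments.
Unset Strict Implicit.
Unset Printing Implicit Defensive.

Import GRing.Theory.
Local Open Scope ring_scope.
Local Open Scope quotient_scope.

Section Tensor.
Variables (F : fieldType) (V W : lmodType F).
Implicit Types (s t : seq (V * W)).

(* The list [:: (v1, w1); ...; (vn, wn)] stands for the formal sum
   v1 (x) w1 + ... + vn (x) wn; the tensor product is the quotient of the free
   commutative monoid on V * W by the bilinearity relations. It is a group
   because (-v) (x) w is an opposite of v (x) w. *)
Inductive tens_eq : seq (V * W) -> seq (V * W) -> Prop :=
| tens_refl s : tens_eq s s
| tens_sym s t : tens_eq s t -> tens_eq t s
| tens_trans s t u : tens_eq s t -> tens_eq t u -> tens_eq s u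
| tens_cat s s' t t' : tens_eq s t -> tens_eq s' t' ->
    tens_eq (s ++ s') (t ++ t')
| tens_catC s t : tens_eq (s ++ t) (t ++ s)
| tens_0 w : tens_eq [:: (0, w)] [::]
| tens_Dl v v' w : tens_eq [:: (v + v', w)] [:: (v, w); (v', w)]
| tens_Dr v w w' : tens_eq [:: (v, w + w')] [:: (v, w); (v, w')]
| tens_Z (c : F) v w : tens_eq [:: (c *: v, w)] [:: (v, c *: w)].

Definition tens_rel s t : bool := `[< tens_eq s t >].

Lemma tens_rel_refl : reflexive tens_rel.
Proof. by move=> s; apply/asboolP; apply: tens_refl. Qed.
Lemma tens_rel_sym : symmetric tens_rel.
Proof. by move=> s t; apply/idP/idP => /asboolP h; apply/asboolP/tens_sym. Qed.
Lemma tens_rel_trans : transitive tens_rel.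
Proof.
by move=> t s u /asboolP h /asboolP h'; apply/asboolP; apply: tens_trans h h'.
Qed.
Canonical tens_equiv := EquivRel tens_rel tens_rel_refl tens_rel_sym tens_rel_trans.

Definition tensor : Type := {eq_quot tens_equiv}.
HB.instance Definition _ := Choice.on tensor.

Definition tcls s : tensor := \pi_({eq_quot tens_equiv}) s.
Definition trepr (x : tensor) : seq (V * W) := @repr _ {eq_quot tens_equiv} x.

Lemma treprK x : tcls (trepr x) = x.
Proof. exact: reprK. Qed.

Lemma tclsP s t : tens_eq s t <-> tcls s = tcls t.
Proof.
split=> [h | /eqquotP h]; last exact/asboolP.
by apply/eqquotP; apply/asboolP.
Qed.

Lemma trepr_cls s : tens_eq (trepr (tcls s)) s.
Proof. by apply/tclsP; rewrite treprK. Qed.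

Definition tadd (x y : tensor) := tcls (trepr x ++ trepr y).
Definition tscale (c : F) (x : tensor) :=
  tcls [seq (c *: p.1, p.2) | p <- trepr x].

Lemma tadd_cls s t : tadd (tcls s) (tcls t) = tcls (s ++ t).
Proof. by apply/tclsP; apply: tens_cat; apply: trepr_cls. Qed.

Definition smap c s := [seq (c *: p.1, p.2) | p <- s].

Lemma smap_eq c s t : tens_eq s t -> tens_eq (smap c s) (smap c t).
Proof.
elim=> {s t} /=.
- by move=> s; apply: tens_refl.
- by move=> s t _; apply: tens_sym.
- by move=> s t u _ h _; apply: tens_trans.
- by move=> s s' t t' _ h _ h'; rewrite /smap !map_cat; apply: tens_cat.
- by move=> s t; rewrite /smap !map_cat; apply: tens_catC.
- by move=> w; rewrite scaler0; apply: tens_0.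
- by move=> v v' w; rewrite scalerDr; apply: tens_Dl.
- by move=> v w w'; apply: tens_Dr.
- by move=> d v w; rewrite scalerA mulrC -scalerA; apply: tens_Z.
Qed.

Lemma tscale_cls c s : tscale c (tcls s) = tcls (smap c s).
Proof. by apply/tclsP; apply: smap_eq; apply: trepr_cls. Qed.

Lemma smap1 s : smap 1 s = s.
Proof. by elim: s => //= -[v w] s ->; rewrite scale1r. Qed.
Lemma smap0 s : tens_eq (smap 0 s) [::].
Proof.
elim: s => [|[v w] s h] /=; first exact: tens_refl.
by rewrite scale0r; apply: (@tens_cat [:: _] _ [::]) h; apply: tens_0.
Qed.
Lemma smapD c d s : tens_eq (smap (c + d) s) (smap c s ++ smap d s).
Proof.
elim: s => [|[v w] s h] /=; first exact: tens_refl.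
rewrite scalerDl.
apply: tens_trans (tens_cat (tens_Dl _ _ _) h) _ => /=.
apply: (@tens_cat [:: _] _ [:: _]); first exact: tens_refl.
rewrite -cat_cons -[X in tens_eq _ (_ ++ X)]cat1s catA -[X in tens_eq X _]cat1s.
rewrite catA; apply: tens_cat; [exact: tens_catC | exact: tens_refl].
Qed.

Definition tzero := tcls [::].
Definition topp x := tscale (-1) x.

Lemma ttind (P : tensor -> Prop) : (forall s, P (tcls s)) -> forall x, P x.
Proof. by move=> h x; rewrite -[x]treprK. Qed.

Lemma taddA : associative tadd.
Proof.
elim/ttind=> s; elim/ttind=> t; elim/ttind=> u.
by rewrite !tadd_cls catA.
Qed.
Lemma taddC : commutative tadd.
Proof.
by elim/ttind=> s; elim/ttind=> t; rewrite !tadd_cls; apply/tclsP/tens_catC.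
Qed.
Lemma tadd0 : left_id tzero tadd.
Proof. by elim/ttind=> s; rewrite tadd_cls. Qed.
Lemma taddN : left_inverse tzero topp tadd.
Proof.
elim/ttind=> s; rewrite /topp tscale_cls tadd_cls; apply/tclsP.
have h := smap0 s; rewrite -(addNr 1) in h.
rewrite -{2}[s]smap1; exact: tens_trans (tens_sym (smapD _ _ _)) h.
Qed.
HB.instance Definition _ := GRing.isZmodule.Build tensor taddA taddC tadd0 taddN.

Lemma tscaleA a b x : tscale a (tscale b x) = tscale (a * b) x.
Proof.
elim/ttind: x => s; rewrite !tscale_cls; congr tcls; rewrite /smap -map_comp.
by apply: eq_map => p /=; rewrite scalerA.
Qed.
Lemma tscale1 : left_id 1 tscale.
Proof. by elim/ttind=> s; rewrite tscale_cls smap1. Qed.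
Lemma tscaleDr : right_distributive tscale +%R.
Proof.
move=> c; elim/ttind=> s; elim/ttind=> t.
by rewrite -[LHS]/(tscale c (tadd _ _)) -[RHS]/(tadd _ _) !(tadd_cls, tscale_cls)
  /smap map_cat.
Qed.
Lemma tscaleDl x : {morph tscale^~ x : a b / a + b}.
Proof.
move=> c d; elim/ttind: x => s.
rewrite -[RHS]/(tadd _ _) !tscale_cls tadd_cls; apply/tclsP; exact: smapD.
Qed.
HB.instance Definition _ := GRing.Zmodule_isLmodule.Build F tensor
  tscaleA tscale1 tscaleDr tscaleDl.

Definition tens (v : V) (w : W) : tensor := tcls [:: (v, w)].

Lemma tclsE s : tcls s = \sum_(p <- s) tens p.1 p.2.
Proof.
elim: s => [|[v w] s ih]; first by rewrite big_nil.
by rewrite big_cons -ih -[RHS]/(tadd _ _) tadd_cls.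
Qed.

Lemma tensZl c v w : tens (c *: v) w = c *: tens v w.
Proof. by rewrite -[RHS]/(tscale _ _) tscale_cls. Qed.

Lemma tens_bilinear : bilinear_for *:%R *:%R tens.
Proof.
split=> [w c v v' | v c w w'] /=.
  rewrite -tensZl -[RHS]/(tadd _ _) tadd_cls; exact/tclsP/tens_Dl.
rewrite -tensZl -[RHS]/(tadd _ _) tadd_cls; apply/tclsP.
apply: tens_trans (tens_Dr _ _ _) _.
apply: (@tens_cat [:: _] _ [:: _]); last exact: tens_refl.
exact/tens_sym/tens_Z.
Qed.
HB.instance Definition _ := bilinear_isBilinear.Build F V W tensor
  *:%R *:%R tens tens_bilinear.

Section Lift.
Variables (U : lmodType F) (b : {bilinear V -> W -> U}).

Definition tlift (x : tensor) : U := \sum_(p <- trepr x) b p.1 p.2.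

Lemma tlift_eq s t : tens_eq s t ->
  \sum_(p <- s) b p.1 p.2 = \sum_(p <- t) b p.1 p.2.
Proof.
elim=> {s t} //=.
- by move=> s t u _ -> _ ->.
- by move=> s s' t t' _ h _ h'; rewrite !big_cat /= h h'.
- by move=> s t; rewrite !big_cat /= addrC.
- by move=> w; rewrite !big_cons !big_nil /= linear0l addr0.
- by move=> v v' w; rewrite !big_cons !big_nil /= !addr0 linearDl.
- by move=> v w w'; rewrite !big_cons !big_nil /= !addr0 linearDr.
- by move=> c v w; rewrite !big_cons !big_nil /= linearZl_LR linearZr_LR.
Qed.

Lemma tlift_cls s : tlift (tcls s) = \sum_(p <- s) b p.1 p.2.
Proof. by apply: tlift_eq; apply: trepr_cls. Qed.

Lemma tlift_linear : linear tlift.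
Proof.
move=> c; elim/ttind=> s; elim/ttind=> t.
rewrite -[X in tlift X]/(tadd (tscale c _) _) tscale_cls tadd_cls !tlift_cls.
rewrite big_cat big_map scaler_sumr /=; congr (_ + _).
by apply: eq_bigr => p _; rewrite linearZl_LR.
Qed.
HB.instance Definition _ := GRing.isLinear.Build F tensor U *:%R tlift tlift_linear.

Lemma tliftE v w : tlift (tens v w) = b v w.
Proof. by rewrite tlift_cls big_seq1. Qed.

Lemma tlift_unique (f : {linear tensor -> U}) :
  (forall v w, f (tens v w) = b v w) -> f =1 tlift.
Proof.
move=> h; elim/ttind=> s; rewrite tlift_cls tclsE linear_sum.
by apply: eq_bigr.
Qed.
End Lift.
End Tensor.

(* The bilinear map with (v (x) w, v' (x) w') |-> m v v' (x) n w w'. *)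
Section TensorMul.
Variables (F : fieldType) (V V' V'' W W' W'' : lmodType F).
Variables (m : {bilinear V -> V' -> V''}) (n : {bilinear W -> W' -> W''}).

Definition tens_mul (x : tensor V W) (y : tensor V' W') : tensor V'' W'' :=
  \sum_(p <- trepr x) \sum_(q <- trepr y) tens (m p.1 q.1) (n p.2 q.2).

Definition tens_mul_l y (v : V) (w : W) : tensor V'' W'' :=
  \sum_(q <- trepr y) tens (m v q.1) (n w q.2).
Lemma tens_mul_l_bilinear y : bilinear_for *:%R *:%R (tens_mul_l y).
Proof.
split=> [w c v v' | v c w w'] /=; rewrite /tens_mul_l scaler_sumr -big_split /=;
  apply: eq_bigr => q _.
- by rewrite linearPl linearPl.
- by rewrite linearPl linearPr.
Qed.
HB.instance Definition _ y := bilinear_isBilinear.Build F V W _ *:%R *:%R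
  (tens_mul_l y) (tens_mul_l_bilinear y).

Definition tens_mul_r x (v : V') (w : W') : tensor V'' W'' :=
  \sum_(p <- trepr x) tens (m p.1 v) (n p.2 w).
Lemma tens_mul_r_bilinear x : bilinear_for *:%R *:%R (tens_mul_r x).
Proof.
split=> [w c v v' | v c w w'] /=; rewrite /tens_mul_r scaler_sumr -big_split /=;
  apply: eq_bigr => q _.
- by rewrite linearPr linearPl.
- by rewrite linearPr linearPr.
Qed.
HB.instance Definition _ x := bilinear_isBilinear.Build F V' W' _ *:%R *:%R
  (tens_mul_r x) (tens_mul_r_bilinear x).

Lemma tens_mulEr x y : tens_mul x y = tlift (tens_mul_l y) x.
Proof. by []. Qed.
Lemma tens_mulEl x y : tens_mul x y = tlift (tens_mul_r x) y.
Proof. by rewrite /tens_mul exchange_big. Qed.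

Lemma tens_mul_bilinear : bilinear_for *:%R *:%R tens_mul.
Proof.
split=> [y c x x' | x c y y'] /=; first by rewrite !tens_mulEr linearP.
by rewrite !tens_mulEl linearP.
Qed.
HB.instance Definition _ := bilinear_isBilinear.Build F _ _ _ *:%R *:%R
  tens_mul tens_mul_bilinear.

Definition tens_mul_lr v w (v' : V') (w' : W') := tens (m v v') (n w w').
Lemma tens_mul_lr_bilinear v w : bilinear_for *:%R *:%R (tens_mul_lr v w).
Proof.
split=> [y c x x' | x c y y'] /=; rewrite /tens_mul_lr.
  by rewrite linearPr linearPl.
by rewrite linearPr linearPr.
Qed.
HB.instance Definition _ v w := bilinear_isBilinear.Build F V' W' _ *:%R *:%R
  (tens_mul_lr v w) (tens_mul_lr_bilinear v w).

Lemma tens_mulE v w v' w' :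
  tens_mul (tens v w) (tens v' w') = tens (m v v') (n w w').
Proof.
rewrite tens_mulEr tliftE.
by rewrite -[LHS]/(tlift (tens_mul_lr v w) (tens v' w')) tliftE.
Qed.
End TensorMul.

(* No associativity, commutativity or unit is assumed. *)
Structure algebra (F : fieldType) := Algebra {
  alg_car :> lmodType F;
  alg_mul : {bilinear alg_car -> alg_car -> alg_car}
}.
Arguments alg_mul {F a}.
Notation "x ** y" := (alg_mul x y) (at level 40, left associativity) : ring_scope.

Section AlgebraNotions.
Variables (F : fieldType).
Implicit Types (A B : algebra F).

Definition commutator A (x y : A) : A := x ** y - y ** x.
Definition associator A (x y z : A) : A := (x ** y) ** z - x ** (y ** z).

Definition is_identity A (e : A) := forall x : A, e ** x = x /\ x ** e = x.

Definition associative_algebra A := forall x y z : A, associator x y z = 0.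

Definition alternative_algebra A :=
  forall x y : A, associator x x y = 0 /\ associator y x x = 0.

Definition in_center A (z : A) :=
  (forall x : A, commutator z x = 0) /\
  (forall x y : A, [/\ associator z x y = 0, associator x z y = 0
                     & associator x y z = 0]).

Definition alg_hom A B (f : {linear A -> B}) := {morph f : x y / x ** y}.

Definition alg_isomorphic A B :=
  exists f : {linear A -> B}, bijective f /\ alg_hom f.

End AlgebraNotions.

(* A Z_2-graded algebra, given by its homogeneous components and the four
   restrictions of its product; [total_algebra] is the algebra itself. *)
Structure graded_algebra (F : fieldType) := GradedAlgebra {
  even_part : lmodType F;
  odd_part : lmodType F;
  mul00 : {bilinear even_part -> even_part -> even_part};
  mul01 : {bilinear even_part -> odd_part -> odd_part};
  mul10 : {bilinear odd_part -> even_part -> odd_part};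
  mul11 : {bilinear odd_part -> odd_part -> even_part}
}.

Arguments mul00 {F g}.
Arguments mul01 {F g}.
Arguments mul10 {F g}.
Arguments mul11 {F g}.

Section GradedAlgebra.
Variables (F : fieldType) (G : graded_algebra F).

Definition even_algebra : algebra F := Algebra (@mul00 F G).

Definition total_mul (x y : even_part G * odd_part G) : even_part G * odd_part G :=
  (mul00 x.1 y.1 + mul11 x.2 y.2, mul01 x.1 y.2 + mul10 x.2 y.1).

Lemma total_mul_bilinear : bilinear_for *:%R *:%R total_mul.
Proof.
split=> [y c x x' | x c y y'] /=; rewrite /total_mul /=; congr (_, _);
  by rewrite ?linearPl ?linearPr /= addrACA scalerDr.
Qed.
HB.instance Definition _ := bilinear_isBilinear.Build F _ _ _ *:%R *:%R
  total_mul total_mul_bilinear.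

Definition total_algebra : algebra F := @Algebra F (even_part G * odd_part G)%type total_mul.

Definition of_even (a : even_part G) : total_algebra := (a, 0).
Definition of_odd (x : odd_part G) : total_algebra := (0, x).

End GradedAlgebra.
Arguments of_even {F G} a.
Arguments of_odd {F G} x.

Record Gamma_algebra (F : fieldType) (G : graded_algebra F) : Prop := {
  Gamma_identity : exists e : even_part G,
    is_identity (e : even_algebra G) /\ is_identity (of_even e);
  Gamma_assoc : associative_algebra (even_algebra G);
  Gamma_comm01 : forall (a : even_part G) (x : odd_part G),
    commutator (of_even a) (of_odd x) = 0;
  Gamma_assoc0 : forall (a : even_part G) (y z : total_algebra G),
    associator (of_even a) y z = 0;
  Gamma_center : forall x y : odd_part G,
    in_center (mul11 x y : even_algebra G);
  Gamma_anticomm : forall x y : odd_part G,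
    of_odd x ** of_odd y + of_odd y ** of_odd x = 0;
  Gamma_square : forall x : odd_part G, of_odd x ** of_odd x = 0;
  Gamma_cyclic : forall x y z : odd_part G,
    (of_odd x ** of_odd y) ** of_odd z + (of_odd y ** of_odd z) ** of_odd x
    + (of_odd z ** of_odd x) ** of_odd y = 0
}.

(* The G-envelope of B: no sign appears in
   (g (x) b) (g' (x) b') = g g' (x) b b'. *)
Definition graded_tensor (F : fieldType) (G B : graded_algebra F) :
    graded_algebra F :=
  @GradedAlgebra F (tensor (even_part G) (even_part B)) (tensor (odd_part G) (odd_part B))
    (tens_mul (@mul00 F G) (@mul00 F B)) (tens_mul (@mul01 F G) (@mul01 F B))
    (tens_mul (@mul10 F G) (@mul10 F B)) (tens_mul (@mul11 F G) (@mul11 F B)).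

Definition envelope (F : fieldType) (G B : graded_algebra F) : algebra F :=
  total_algebra (graded_tensor G B).

Definition mx22 (T : Type) (a b c d : T) : 'M[T]_2 :=
  \matrix_(i, j) if i == 0 then if j == 0 then a else b
                  else if j == 0 then c else d.

Definition symplectic (V : zmodType) (X : 'M[V]_2) : 'M[V]_2 :=
  mx22 (X 1 1) (- X 0 1) (- X 1 0) (X 0 0).

Section B42.
Variable F : fieldType.
Implicit Types (a b : 'M[F]_2) (u v : 'rV[F]_2).

(* Cay is the space of row vectors, with m_1 = 'e_0 and m_2 = 'e_1. *)
Definition B42_mul00 a b : 'M[F]_2 := a *m b.
Definition B42_mul01 a u : 'rV[F]_2 := u *m a.
Definition B42_mul10 u a : 'rV[F]_2 := B42_mul01 (symplectic a) u.
Definition B42_mul11 u v : 'M[F]_2 :=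
  mx22 (- (u 0 0 * v 0 1)) (- (u 0 1 * v 0 1)) (u 0 0 * v 0 0) (u 0 1 * v 0 0).

Lemma B42_mul01_bilinear : bilinear_for *:%R *:%R B42_mul01.
Proof.
split=> [u c a a' | a c u u'] /=; rewrite /B42_mul01.
  by rewrite mulmxDr -scalemxAr.
by rewrite mulmxDl -scalemxAl.
Qed.
Lemma B42_mul00_bilinear : bilinear_for *:%R *:%R B42_mul00.
Proof.
split=> [u c a a' | a c u u'] /=; rewrite /B42_mul00.
  by rewrite mulmxDl -scalemxAl.
by rewrite mulmxDr -scalemxAr.
Qed.
Lemma B42_mul10_bilinear : bilinear_for *:%R *:%R B42_mul10.
Proof.
split=> [a c u u' | u c a a'] /=; rewrite /B42_mul10 /B42_mul01.
  by rewrite mulmxDl -scalemxAl.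
rewrite scalemxAr -mulmxDr; congr (_ *m _); apply/matrixP=> i j.
by rewrite !mxE; do 2 case: ifP => _; rewrite ?mulrN ?opprD.
Qed.
Lemma B42_mul11_bilinear : bilinear_for *:%R *:%R B42_mul11.
Proof.
split=> [v c u u' | u c v v'] /=; rewrite /B42_mul11; apply/matrixP=> i j;
  rewrite !mxE; do 2 case: ifP => _;
  by rewrite ?mulrDl ?mulrDr ?opprD ?mulrN ?mulrA // ?[_ * c]mulrC.
Qed.
HB.instance Definition _ := bilinear_isBilinear.Build F _ _ _ *:%R *:%R
  B42_mul00 B42_mul00_bilinear.
HB.instance Definition _ := bilinear_isBilinear.Build F _ _ _ *:%R *:%R
  B42_mul01 B42_mul01_bilinear.
HB.instance Definition _ := bilinear_isBilinear.Build F _ _ _ *:%R *:%R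
  B42_mul10 B42_mul10_bilinear.
HB.instance Definition _ := bilinear_isBilinear.Build F _ _ _ *:%R *:%R
  B42_mul11 B42_mul11_bilinear.

Definition B42 : graded_algebra F :=
  GradedAlgebra B42_mul00 B42_mul01 B42_mul10 B42_mul11.

Lemma B42_mul01E i j k :
  B42_mul01 (delta_mx i j) 'e_k = (i == k)%:R *: 'e_j.
Proof.
rewrite /B42_mul01 mul_delta_mx_cond eq_sym.
by case: eqP => _; rewrite ?scale1r ?scale0r.
Qed.

Lemma B42_mul11E :
  [/\ B42_mul11 'e_0 'e_0 = delta_mx 1 0, B42_mul11 'e_1 'e_1 = - delta_mx 0 1,
      B42_mul11 'e_0 'e_1 = - delta_mx 0 0 & B42_mul11 'e_1 'e_0 = delta_mx 1 1].
Proof.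
by split; apply/matrixP=> -[[|[|[]]]//= ?] [[|[|[]]]//= ?];
  rewrite !mxE /= ?(mulr0, mul0r, mulr1, oppr0).
Qed.

Definition M2_algebra : algebra F := even_algebra B42.

End B42.

(* Matrices over a vector space V, as a vector space over F: the library only
   makes 'M[R]_2 a module over R. *)
Section Mat2.
Variables (F : fieldType) (V : lmodType F).

Definition mat2 : Type := 'M[V]_2.
HB.instance Definition _ := GRing.Zmodule.copy mat2 'M[V]_2.

Definition mat2_entry (X : mat2) (i j : 'I_2) : V := (X : 'M[V]_2) i j.
Definition mat2_scale (c : F) (X : mat2) : mat2 :=
  \matrix_(i, j) (c *: mat2_entry X i j).

Lemma mat2_scaleA a b X : mat2_scale a (mat2_scale b X) = mat2_scale (a * b) X.
Proof. by apply/matrixP=> i j; rewrite !mxE /mat2_entry !mxE scalerA. Qed.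
Lemma mat2_scale1 : left_id 1 mat2_scale.
Proof. by move=> X; apply/matrixP=> i j; rewrite !mxE scale1r. Qed.
Lemma mat2_scaleDr : right_distributive mat2_scale +%R.
Proof. by move=> c X Y; apply/matrixP=> i j; rewrite !mxE /mat2_entry !mxE scalerDr. Qed.
Lemma mat2_scaleDl X : {morph mat2_scale^~ X : a b / a + b}.
Proof. by move=> a b; apply/matrixP=> i j; rewrite !mxE scalerDl. Qed.
HB.instance Definition _ := GRing.Zmodule_isLmodule.Build F mat2
  mat2_scaleA mat2_scale1 mat2_scaleDr mat2_scaleDl.
End Mat2.

(* M_2(G_0) + G_1^2 with <u, v> = uv; a pair in G_1^2 is a row vector, on which
   matrices over G_0 act on the right. *)
Section MatrixModel.
Variables (F : fieldType) (G : graded_algebra F).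
Implicit Types (X Y : mat2 (even_part G)) (u v : odd_part G * odd_part G).

Definition M2G_mulmx X Y : mat2 (even_part G) :=
  \matrix_(i, j) \sum_k mul00 (mat2_entry X i k) (mat2_entry Y k j).

Definition M2G_rvmx u X : odd_part G * odd_part G :=
  (mul10 u.1 (mat2_entry X 0 0) + mul10 u.2 (mat2_entry X 1 0),
   mul10 u.1 (mat2_entry X 0 1) + mul10 u.2 (mat2_entry X 1 1)).

Definition M2G_form u v : mat2 (even_part G) :=
  mx22 (- mul11 u.1 v.2) (- mul11 u.2 v.2) (mul11 u.1 v.1) (mul11 u.2 v.1).

Definition M2G_mul (X Y : mat2 (even_part G) * (odd_part G * odd_part G)) :
    mat2 (even_part G) * (odd_part G * odd_part G) :=
  (M2G_mulmx X.1 Y.1 + M2G_form X.2 Y.2,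
   M2G_rvmx Y.2 X.1 + M2G_rvmx X.2 (symplectic Y.1)).

Lemma M2G_mul_bilinear : bilinear_for *:%R *:%R M2G_mul.
Proof.
have eD (X Y : mat2 (even_part G)) i j :
  mat2_entry (X + Y) i j = mat2_entry X i j + mat2_entry Y i j by rewrite /mat2_entry mxE.
have eZ c (X : mat2 (even_part G)) i j :
  mat2_entry (c *: X) i j = c *: mat2_entry X i j by rewrite /mat2_entry mxE.
have eM X Y i j : mat2_entry (M2G_mulmx X Y) i j =
    \sum_k mul00 (mat2_entry X i k) (mat2_entry Y k j) by rewrite /mat2_entry mxE.
have mP (X Y : mat2 (even_part G)) : (forall i j, mat2_entry X i j = mat2_entry Y i j) -> X = Y.
  by move=> h; apply/matrixP.
have sP c (X Y : mat2 (even_part G)) :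
  symplectic (c *: X + Y) = c *: (symplectic X : mat2 (even_part G)) + symplectic Y.
  apply/mP=> i j; rewrite eD eZ /mat2_entry !mxE.
  by do 2 case: ifP => _; rewrite ?opprD ?scalerN.
have rl c u u' X : M2G_rvmx (c *: u + u') X = c *: M2G_rvmx u X + M2G_rvmx u' X.
  by rewrite /M2G_rvmx; congr (_, _); rewrite /= !linearPl /= addrACA scalerDr.
have rr c u X Y : M2G_rvmx u (c *: X + Y) = c *: M2G_rvmx u X + M2G_rvmx u Y.
  by rewrite /M2G_rvmx; congr (_, _); rewrite /= !eD !eZ !linearPr /= addrACA scalerDr.
have z1 c (p : mat2 (even_part G) * (odd_part G * odd_part G)) :
  (c *: p).1 = c *: p.1 by [].
have z2 c (p : mat2 (even_part G) * (odd_part G * odd_part G)) :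
  (c *: p).2 = c *: p.2 by [].
split=> [Y c X X' | X c Y Y'] /=; rewrite /M2G_mul /=; congr (_, _).
- rewrite z1 /= scalerDr addrACA; congr (_ + _); apply/mP=> i j; rewrite eD eZ.
    by rewrite !eM scaler_sumr -big_split; apply: eq_bigr => k _; rewrite eD eZ linearPl.
  by rewrite /mat2_entry !mxE; do 2 case: ifP => _; rewrite linearPl ?opprD ?scalerN.
- by rewrite z2 /= rr rl scalerDr addrACA.
- rewrite z1 /= scalerDr addrACA; congr (_ + _); apply/mP=> i j; rewrite eD eZ.
    by rewrite !eM scaler_sumr -big_split; apply: eq_bigr => k _; rewrite eD eZ linearPr.
  by rewrite /mat2_entry !mxE; do 2 case: ifP => _; rewrite linearPr ?opprD ?scalerN.
- by rewrite z2 /= rl sP rr scalerDr addrACA.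
Qed.
HB.instance Definition _ := bilinear_isBilinear.Build F _ _ _ *:%R *:%R
  M2G_mul M2G_mul_bilinear.

Definition M2G : algebra F :=
  @Algebra F (mat2 (even_part G) * (odd_part G * odd_part G))%type M2G_mul.

End MatrixModel.

Definition alternative_M2_algebra (F : fieldType) (A : algebra F) :=
  alternative_algebra A /\
  exists e : A, is_identity e /\
    exists f : {linear M2_algebra F -> A},
      alg_hom f /\ f (1%:M : 'M[F]_2) = e.

(* Main.v *)
From HB Require Import structures.
Require Import Defs.
From mathcomp Require Import all_boot all_order all_algebra.

Set Implicit Arguments.
Unset Strict Implicit.
Unset Printing Implicit Defensive.

Import GRing.Theory.
Local Open Scope ring_scope.

(** Why the theorem holds.

    Coordinates. The even part of [envelope G (B42 F)] is G_0 (x) M_2(F) and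
    its odd part is G_1 (x) F^2.  Reading off the coefficients of the matrix
    units and of m_1, m_2 identifies them with M_2(G_0) and G_1^2, and the
    product of pure tensors becomes the matrix product, because G_0 commutes with
    G_1 ([envelope_iso]).

    Every M_2(G_0) + G_1^2 is an alternative M_2-algebra.  Write an element as
    (P, u), the product as (PQ + B(u,v), vP + uQ* ).  Here M_2(G_0) is
    associative, acts on G_1^2 through a commutative quotient of G_0, and
    P + P* is a scalar matrix; B is bilinear over these actions, has central
    entries, satisfies B(u,v)* = B(v,u), and B(u,u) is scalar.  Expanding the
    associators (X,X,Y) and (Y,X,X), everything cancels except
    v B(u,u) - u B(v,u), and this is zero by the cyclic identity
    ([M2G_alternative]).

    Every alternative M_2-algebra A has this form.  The images of e_11 and e_22
    are complementary idempotents and give the Peirce components A_11, A_12,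
    A_21, A_22; let u and v be the images of e_12 and e_21.  Take G_0 = A_11
    and G_1 = {x in A_12 | x v = 0}, with <x,y> = u(xy).  In an alternative
    algebra the product of two components vanishes unless the indices match,
    except that A_12 A_12 lies in A_21 and A_21 A_21 in A_12.  As the
    associator is alternating, most associators of Peirce elements can be
    permuted until both of their terms vanish by these rules, which
    yields all the laws of a Gamma-algebra ([coord_laws]) and the whole
    multiplication table of the sums
      a + b u + v c + v(d u) + x + u y      (a, b, c, d in G_0, x, y in G_1),
    which is the one of M_2(G_0) + G_1^2 ([peirce_sum_mul]).  Each element of A
    is such a sum in exactly one way ([peirce_sum_eq0], [peirce_sum_surj]).

    No step divides by 2 or 3.  The one place where the usual Peirce argument
    would is the vanishing of A_11 A_2k, where alternativity applied to the
    idempotent alone only gives 2xy = 0; the Moufang-type identity [associator_mull] replaces it. *)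

(** * Isomorphisms of algebras *)

Section Isomorphisms.
Variable F : fieldType.

Lemma linear_bijective (U V : lmodType F) (f : {linear U -> V}) :
    (forall x, f x = 0 -> x = 0) -> (forall y, exists x, f x = y) -> bijective f.
Proof.
move=> f_ker f_surj.
have f_surj' y : exists x, f x == y by have [x <-] := f_surj y; exists x.
have fK y : f (xchoose (f_surj' y)) = y by exact/eqP/(xchooseP (f_surj' y)).
exists (fun y => xchoose (f_surj' y)) => // x.
by apply/subr0_eq/f_ker; rewrite linearB fK subrr.
Qed.

Lemma alg_iso_trans (A B C : algebra F) :
  alg_isomorphic A B -> alg_isomorphic B C -> alg_isomorphic A C.
Proof.
move=> [f [f_bij fM]] [g [g_bij gM]]; exists (g \o f).
by split=> [|x y]; [apply: bij_comp | rewrite /= fM gM].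
Qed.

Lemma alg_iso_inv (A B : algebra F) : alg_isomorphic A B ->
  exists (f : {linear A -> B}) (g : {linear B -> A}),
    [/\ alg_hom f, alg_hom g, cancel f g & cancel g f].
Proof.
move=> [f [[g fK gK] fM]].
have g_lin : linear g by move=> c x y; rewrite -{1}[x]gK -{1}[y]gK -linearP fK.
have gM : {morph g : x y / x ** y}.
  by move=> x y; rewrite -{1}[x]gK -{1}[y]gK -fM fK.
pose gL : {linear B -> A} := HB.pack g (GRing.isLinear.Build _ _ _ _ g g_lin).
by exists f, gL.
Qed.

Lemma alg_iso_sym (A B : algebra F) : alg_isomorphic A B -> alg_isomorphic B A.
Proof.
by move=> /alg_iso_inv[f [g [_ gM fK gK]]]; exists g; split=> //; exists f.
Qed.

Lemma alternative_M2_algebra_iso (A B : algebra F) :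
  alg_isomorphic A B -> alternative_M2_algebra A -> alternative_M2_algebra B.
Proof.
move=> /alg_iso_inv[f [g [fM gM fK gK]]] [altA [e [eP [h [hM h1]]]]].
have f_ass x y z : f (associator x y z) = associator (f x) (f y) (f z).
  by rewrite /associator linearB !fM.
split=> [x y|].
  have [xxy yxx] := altA (g x) (g y).
  by rewrite -[x]gK -[y]gK -!f_ass xxy yxx linear0.
exists (f e); split=> [x|].
  by have [ex xe] := eP (g x); rewrite -[x]gK -!fM ex xe.
exists (f \o h); split=> [x y|]; first by rewrite /= hM fM.
by rewrite /= h1.
Qed.

End Isomorphisms.

(** * The envelope in coordinates *)

Section EnvelopeIso.
Variable F : fieldType.

Lemma ord2P (P : 'I_2 -> Prop) : P 0 -> P 1 -> forall i, P i.
Proof.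
move=> P0 P1 [[|[|//]] i_lt]; [move: P0 | move: P1]; congr P; exact: val_inj.
Qed.

Lemma sum2E (V : nmodType) (f : 'I_2 -> V) : \sum_i f i = f 0 + f 1.
Proof.
rewrite !big_ord_recl big_ord0 addr0; congr (_ + f _); exact: val_inj.
Qed.

Lemma mat2P (V : Type) (X Y : 'M[V]_2) :
  X 0 0 = Y 0 0 -> X 0 1 = Y 0 1 -> X 1 0 = Y 1 0 -> X 1 1 = Y 1 1 -> X = Y.
Proof. by move=> *; apply/matrixP; do 2 apply: ord2P. Qed.

Section Coordinates.
Variable V : lmodType F.

Definition tens_coord_mx (v : V) (b : 'M[F]_2) : mat2 V :=
  \matrix_(i, j) (b i j *: v).
Definition tens_coord_rv (v : V) (m : 'rV[F]_2) : V * V :=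
  (m 0 0 *: v, m 0 1 *: v).

Lemma tens_coord_mx_bilinear : bilinear_for *:%R *:%R tens_coord_mx.
Proof.
split=> [b c v v' | v c b b'] /=; apply/matrixP=> i j; rewrite !mxE /mat2_entry !mxE.
  by rewrite scalerDr !scalerA mulrC.
by rewrite scalerDl scalerA.
Qed.
HB.instance Definition _ := bilinear_isBilinear.Build F _ _ _ *:%R *:%R
  tens_coord_mx tens_coord_mx_bilinear.

Lemma tens_coord_rv_bilinear : bilinear_for *:%R *:%R tens_coord_rv.
Proof.
split=> [m c v v' | v c m m'] /=; rewrite /tens_coord_rv; congr (_, _) => /=;
  rewrite ?mxE.
- by rewrite scalerDr !scalerA mulrC.
- by rewrite scalerDr !scalerA mulrC.
- by rewrite scalerDl scalerA.
- by rewrite scalerDl scalerA.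
Qed.
HB.instance Definition _ := bilinear_isBilinear.Build F _ _ _ *:%R *:%R
  tens_coord_rv tens_coord_rv_bilinear.

Lemma tens_ind (W : lmodType F) (P : tensor V W -> Prop) :
  (forall x y, P x -> P y -> P (x + y)) -> P 0 -> (forall v w, P (tens v w)) ->
  forall x, P x.
Proof. by move=> PD P0 Pt x; rewrite -[x]treprK tclsE; apply: big_rec => *; auto. Qed.

Lemma tens_coord_mx_bij : bijective (tlift tens_coord_mx).
Proof.
exists (fun X : mat2 V =>
  \sum_i \sum_j tens (mat2_entry X i j) (delta_mx i j : 'M[F]_2)).
  elim/tens_ind => [x y hx hy||v w].
  - rewrite -[in RHS]hx -[in RHS]hy -big_split; apply: eq_bigr => i _.
    rewrite -big_split; apply: eq_bigr => j _ /=.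
    by rewrite linearD /mat2_entry mxE linearDl.
  - rewrite linear0; apply: big1 => i _; apply: big1 => j _.
    by rewrite /mat2_entry mxE linear0l.
  - rewrite tliftE [in RHS](matrix_sum_delta w) linear_sumr.
    apply: eq_bigr => i _; rewrite linear_sumr; apply: eq_bigr => j _.
    by rewrite /mat2_entry mxE linearZl_LR linearZr_LR.
move=> X; rewrite linear_sum; apply/matrixP=> k l.
rewrite summxE (bigD1 k) //= linear_sum summxE (bigD1 l) //= big1 => [|j jl].
  rewrite addr0 big1 => [|i ik].
    by rewrite addr0 /= tliftE !mxE !eqxx scale1r.
  rewrite linear_sum summxE; apply: big1 => j _.
  by rewrite /= tliftE !mxE [k == i]eq_sym (negPf ik) scale0r.
by rewrite /= tliftE !mxE [l == j]eq_sym (negPf jl) andbF scale0r.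
Qed.

Lemma tens_coord_rv_bij : bijective (tlift tens_coord_rv).
Proof.
exists (fun u : V * V => tens u.1 ('e_0 : 'rV[F]_2) + tens u.2 ('e_1 : 'rV[F]_2)).
  elim/tens_ind => [x y hx hy||v w].
  - by rewrite linearD /= !linearDl addrACA hx hy.
  - by rewrite linear0 /= !linear0l addr0.
  - rewrite tliftE /= !linearZl_LR -!linearZr_LR -linearDr; congr tens.
    by rewrite [RHS]row_sum_delta sum2E.
move=> [u1 u2]; rewrite linearD /= !tliftE /= /tens_coord_rv !mxE /=.
by congr (_, _); rewrite /= scale1r scale0r ?addr0 ?add0r.
Qed.
End Coordinates.

Section Iso.
Variable G : graded_algebra F.

Definition envelope_coord (X : envelope G (B42 F)) : M2G G :=
  (tlift (@tens_coord_mx (even_part G)) X.1, tlift (@tens_coord_rv (odd_part G)) X.2).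

Lemma envelope_coord_linear : linear envelope_coord.
Proof. by move=> c X Y; rewrite /envelope_coord /= !linearP. Qed.
HB.instance Definition _ := GRing.isLinear.Build F _ _ _
  envelope_coord envelope_coord_linear.

Lemma envelope_coord_bij : bijective envelope_coord.
Proof.
have [g1 fK1 gK1] := tens_coord_mx_bij (even_part G).
have [g2 fK2 gK2] := tens_coord_rv_bij (odd_part G).
exists (fun X : M2G G => (g1 X.1, g2 X.2) : envelope G (B42 F)) => -[x y].
  by rewrite /envelope_coord /= fK1 fK2.
by rewrite /envelope_coord /= gK1 gK2.
Qed.

Definition env_even (a : even_part G) (b : 'M[F]_2) : envelope G (B42 F) :=
  (tens a b, 0).
Definition env_odd (x : odd_part G) (m : 'rV[F]_2) : envelope G (B42 F) :=
  (0, tens x m).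

Lemma envelope_ind (P : envelope G (B42 F) -> Prop) :
  (forall X Y, P X -> P Y -> P (X + Y)) ->
  (forall a b, P (env_even a b)) -> (forall x m, P (env_odd x m)) ->
  forall X, P X.
Proof.
move=> PD Pe Po [X Y].
have -> : (X, Y) = ((X, 0) : envelope G (B42 F)) + (0, Y).
  by congr (_, _); rewrite /= ?addr0 ?add0r.
apply: (PD).
  elim/tens_ind: X => [X X' hX hX'||//].
    suff -> : (X + X', 0) = ((X, 0) : envelope G (B42 F)) + (X', 0).
      exact: PD.
    by congr (_, _); rewrite /= addr0.
  by have := Pe 0 0; rewrite /env_even linear0l.
elim/tens_ind: Y => [Y Y' hY hY'||//].
  suff -> : (0, Y + Y') = ((0, Y) : envelope G (B42 F)) + (0, Y').
    exact: PD.
  by congr (_, _); rewrite /= addr0.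
by have := Po 0 0; rewrite /env_odd linear0l.
Qed.

End Iso.
End EnvelopeIso.

Section MatrixModelEntries.
Variables (F : fieldType) (G : graded_algebra F).
Implicit Types (P Q : mat2 (even_part G)) (u v : odd_part G * odd_part G).

Lemma M2G_mulmxE P Q i j :
  M2G_mulmx P Q i j = mul00 (P i 0) (Q 0 j) + mul00 (P i 1) (Q 1 j).
Proof. by rewrite mxE sum2E. Qed.

Lemma M2G_mulmx0l Q : M2G_mulmx (0 : mat2 (even_part G)) Q = 0.
Proof. by apply/matrixP=> i j; rewrite M2G_mulmxE !mxE !linear0l addr0. Qed.
Lemma M2G_mulmx0r P : M2G_mulmx P (0 : mat2 (even_part G)) = 0.
Proof. by apply/matrixP=> i j; rewrite M2G_mulmxE !mxE !linear0r addr0. Qed.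
Lemma M2G_rvmx0l P : M2G_rvmx (0 : odd_part G * odd_part G) P = 0.
Proof. by rewrite /M2G_rvmx /= !linear0l addr0. Qed.
Lemma M2G_rvmx0r u : M2G_rvmx u (0 : mat2 (even_part G)) = 0.
Proof. by rewrite /M2G_rvmx /mat2_entry !mxE !linear0r addr0. Qed.
Lemma M2G_form0l v : M2G_form (0 : odd_part G * odd_part G) v = 0.
Proof. by apply: mat2P; rewrite !mxE /= ?linear0l ?oppr0. Qed.
Lemma M2G_form0r u : M2G_form u (0 : odd_part G * odd_part G) = 0.
Proof. by apply: mat2P; rewrite !mxE /= ?linear0r ?oppr0. Qed.
Lemma symplectic0 (V : zmodType) : symplectic (0 : 'M[V]_2) = 0.
Proof. by apply: mat2P; rewrite !mxE /= ?oppr0. Qed.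

(** Clears the three summands that vanish in the product of two homogeneous
    elements of the matrix model. *)
Definition M2G_0E := (M2G_mulmx0l, M2G_mulmx0r, M2G_rvmx0l, M2G_rvmx0r,
  M2G_form0l, M2G_form0r, symplectic0, addr0, add0r).
End MatrixModelEntries.

Section EnvelopeHom.
Variables (F : fieldType) (G : graded_algebra F).

Let envE00 (a a' : even_part G) b b' :
  env_even a b ** env_even a' b' = env_even (mul00 a a') (b *m b').
Proof.
by congr (_, _); rewrite /= ?tens_mulE !(linear0l, linear0r, addr0).
Qed.
Let envE01 (a : even_part G) b (x : odd_part G) m :
  env_even a b ** env_odd x m = env_odd (mul01 a x) (m *m b).
Proof.
by congr (_, _); rewrite /= ?tens_mulE !(linear0l, linear0r, addr0, add0r).
Qed.
Let envE10 (a : even_part G) b (x : odd_part G) m :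
  env_odd x m ** env_even a b = env_odd (mul10 x a) (m *m symplectic b).
Proof.
by congr (_, _); rewrite /= ?tens_mulE !(linear0l, linear0r, addr0, add0r).
Qed.
Let envE11 (x x' : odd_part G) m m' :
  env_odd x m ** env_odd x' m' = env_even (mul11 x x') (B42_mul11 m m').
Proof.
by congr (_, _); rewrite /= ?tens_mulE !(linear0l, linear0r, addr0, add0r).
Qed.

Let coord_env_even (a : even_part G) b :
  envelope_coord (env_even a b) = (tens_coord_mx a b, 0).
Proof. by rewrite /envelope_coord /= tliftE linear0. Qed.
Let coord_env_odd (x : odd_part G) m :
  envelope_coord (env_odd x m) = (0, tens_coord_rv x m).
Proof. by rewrite /envelope_coord /= tliftE linear0. Qed.

Let coordD : {morph @envelope_coord F G : X Y / X + Y}.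
Proof. exact: linearD. Qed.

Hypothesis Gcomm : forall (a : even_part G) (x : odd_part G), mul01 a x = mul10 x a.

Lemma envelope_coord_hom : {morph @envelope_coord F G : X Y / X ** Y}.
Proof.
move=> X Y; elim/envelope_ind: X => [X X' hX hX'|a b|x m].
- by rewrite linearDl !coordD linearDl hX hX'.
- elim/envelope_ind: Y => [Y Y' hY hY'|a' b'|x' m'].
  + by rewrite linearDr !coordD linearDr hY hY'.
  + rewrite envE00 !coord_env_even.
    congr (_, _); rewrite /= !M2G_0E //.
    apply: mat2P; rewrite !mxE !sum2E /mat2_entry !mxE /=;
    by rewrite !(linearZl_LR, linearZr_LR) !scalerA scalerDl.
  + rewrite envE01 coord_env_even !coord_env_odd.
    congr (_, _); rewrite /= !M2G_0E // Gcomm /M2G_rvmx /tens_coord_rv.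
    congr (_, _); rewrite /mat2_entry !mxE !sum2E /=;
    by rewrite !(linearZl_LR, linearZr_LR) !scalerA scalerDl.
- elim/envelope_ind: Y => [Y Y' hY hY'|a b|x' m'].
  + by rewrite linearDr !coordD linearDr hY hY'.
  + rewrite envE10 coord_env_even !coord_env_odd.
    congr (_, _); rewrite /= !M2G_0E // /M2G_rvmx /tens_coord_rv.
    congr (_, _); rewrite /mat2_entry !mxE !sum2E !mxE /=;
    by rewrite -?scaleNr !(linearZl_LR, linearZr_LR) !scalerA scalerDl.
  + rewrite envE11 coord_env_even !coord_env_odd.
    congr (_, _); rewrite /= !M2G_0E //.
    by apply: mat2P; rewrite !mxE /= linearZl_LR linearZr_LR scalerA ?scaleNr.
Qed.

Lemma envelope_iso : alg_isomorphic (envelope G (B42 F)) (M2G G).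
Proof.
exists (@envelope_coord F G); split; first exact: envelope_coord_bij.
exact: envelope_coord_hom.
Qed.
End EnvelopeHom.

(** * The laws of a Gamma-algebra on homogeneous components *)

Section GammaLaws.
Variables (F : fieldType) (G : graded_algebra F).

(** The same structure as [Gamma_algebra], freed of the embeddings into the total
    algebra.  The law [Gamma_actC] says that commutators of G_0 annihilate G_1:
    since a and x commute, (a,x,b) = 0 and (a,b,x) = 0 give (ba)x = (ab)x. *)
Record Gamma_laws : Prop := {
  Gamma_one : exists e : even_part G,
    (forall a, mul00 e a = a /\ mul00 a e = a) /\ (forall x, mul10 x e = x);
  Gamma_mulA : forall a b c : even_part G,
    mul00 (mul00 a b) c = mul00 a (mul00 b c);
  Gamma_mulC : forall (a : even_part G) (x : odd_part G), mul01 a x = mul10 x a;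
  Gamma_actA : forall (a b : even_part G) (x : odd_part G),
    mul10 x (mul00 a b) = mul10 (mul10 x a) b;
  Gamma_actC : forall (a b : even_part G) (x : odd_part G),
    mul10 (mul10 x a) b = mul10 (mul10 x b) a;
  Gamma_formZl : forall (a : even_part G) (x y : odd_part G),
    mul11 (mul10 x a) y = mul00 a (mul11 x y);
  Gamma_formC : forall (a : even_part G) (x y : odd_part G),
    mul00 (mul11 x y) a = mul00 a (mul11 x y);
  Gamma_form_alt : forall x : odd_part G, mul11 x x = 0;
  Gamma_form_cyc : forall x y z : odd_part G,
    mul10 z (mul11 x y) + mul10 x (mul11 y z) + mul10 y (mul11 z x) = 0
}.

Lemma total_mulE (a b : even_part G) (x y : odd_part G) :
  ((a, x) : total_algebra G) ** (b, y) =
  (mul00 a b + mul11 x y, mul01 a y + mul10 x b).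
Proof. by []. Qed.

Lemma Gamma_form_anti : Gamma_laws -> forall x y : odd_part G,
  mul11 x y = - mul11 y x.
Proof.
move=> laws x y; apply/eqP; rewrite -addr_eq0; apply/eqP.
have := Gamma_form_alt laws (x + y).
by rewrite linearDl !linearDr /= !(Gamma_form_alt laws) addr0 add0r.
Qed.

Lemma Gamma_algebraP : Gamma_algebra G <-> Gamma_laws.
Proof.
split=> [GG|laws].
- have comm (a : even_part G) (x : odd_part G) : mul01 a x = mul10 x a.
    have := congr1 snd (Gamma_comm01 GG a x).
    rewrite /commutator !total_mulE /= !(linear0l, linear0r) addr0 add0r.
    exact: subr0_eq.
  have act1 (a b : even_part G) (x : odd_part G) :
      mul10 x (mul00 a b) = mul10 (mul10 x b) a.
    have := congr1 snd (Gamma_assoc0 GG a (of_even b) (of_odd x)).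
    rewrite /associator !total_mulE /= !(linear0l, linear0r) !(addr0, add0r).
    by rewrite !comm => /subr0_eq.
  have act2 (a b : even_part G) (x : odd_part G) :
      mul10 (mul10 x a) b = mul10 (mul10 x b) a.
    have := congr1 snd (Gamma_assoc0 GG a (of_odd x) (of_even b)).
    rewrite /associator !total_mulE /= !(linear0l, linear0r) !(addr0, add0r).
    by rewrite !comm => /subr0_eq.
  split=> //.
  + have [e [eP eP']] := Gamma_identity GG; exists e; split=> [a|x].
      exact: eP.
    have [_] := eP' (of_odd x); rewrite total_mulE /= => /(congr1 snd) /=.
    by rewrite linear0l add0r.
  + by move=> a b c; apply/subr0_eq/(Gamma_assoc GG a b c).
  + by move=> a b x; rewrite act1 act2.
  + move=> a x y; have := congr1 fst (Gamma_assoc0 GG a (of_odd x) (of_odd y)).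
    rewrite /associator !total_mulE /= !(linear0l, linear0r) !(addr0, add0r).
    by rewrite !comm => /subr0_eq.
  + by move=> a x y; have [/(_ a)/subr0_eq] := Gamma_center GG x y.
  + move=> x; have := congr1 fst (Gamma_square GG x).
    by rewrite total_mulE /= linear0l add0r.
  + move=> x y z; have := congr1 snd (Gamma_cyclic GG x y z).
    rewrite !total_mulE /= !(linear0l, linear0r) !(addr0, add0r).
    by rewrite !comm.
- have [[e [e1 e10]] mulA comm actA actC formZ formC form_alt form_cyc] := laws.
  have assA : associative_algebra (even_algebra G).
    by move=> a b c; apply/eqP; rewrite subr_eq0; apply/eqP/mulA.
  split=> //.
  + exists e; split=> // -[a x]; rewrite !total_mulE /= !comm !(linear0l, linear0r).
    by rewrite !(addr0, add0r) e10; have [-> ->] := e1 a.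
  + move=> a x; rewrite /commutator !total_mulE /= comm !(linear0l, linear0r).
    by rewrite !(addr0, add0r) subrr.
  + move=> a [b x] [c y]; rewrite /associator !total_mulE /=.
    rewrite !(linear0l, linear0r, addr0, add0r) !comm !(linearDl, linearDr) /=.
    by rewrite mulA formZ actA (actC a b y) (actC a c x) subrr.
  + move=> x y; split=> [a|a b]; last by rewrite !assA.
    by apply/eqP; rewrite subr_eq0; apply/eqP/formC.
  + move=> x y; rewrite !total_mulE /= !(linear0l, linear0r) !(addr0, add0r).
    by rewrite (Gamma_form_anti laws x y); congr (_, _); rewrite /= ?addNr ?addr0.
  + by move=> x; rewrite !total_mulE /= !(linear0l, linear0r) !(addr0, add0r) form_alt.
  + move=> x y z; rewrite !total_mulE /= !(linear0l, linear0r) !(addr0, add0r).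
    by congr (_, _); rewrite /= ?linear0l ?addr0 // !comm form_cyc.
Qed.

End GammaLaws.

(** * The matrix model is an alternative M_2-algebra *)

Section MatrixModelAlternative.
Variables (F : fieldType) (G : graded_algebra F).
Hypothesis laws : Gamma_laws G.
Notation mat := (mat2 (even_part G)).
Notation pair := (odd_part G * odd_part G)%type.
Implicit Types (P Q R : mat) (u v w : pair).

Let mulA := Gamma_mulA laws.
Let actA := Gamma_actA laws.
Let actC := Gamma_actC laws.
Let formZ := Gamma_formZl laws.
Let formC := Gamma_formC laws.
Let form_anti := Gamma_form_anti laws.
Let form_alt := Gamma_form_alt laws.

Let formZr (a : even_part G) (x y : odd_part G) :
  mul11 x (mul10 y a) = mul00 a (mul11 x y).
Proof. by rewrite form_anti formZ form_anti linearNr opprK. Qed.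

Lemma M2G_mulmxA P Q R : M2G_mulmx P (M2G_mulmx Q R) = M2G_mulmx (M2G_mulmx P Q) R.
Proof.
apply/matrixP=> i j.
by rewrite !M2G_mulmxE !(linearDl, linearDr) /= !mulA addrACA.
Qed.

Lemma M2G_rvmxA u P Q : M2G_rvmx (M2G_rvmx u P) Q = M2G_rvmx u (M2G_mulmx P Q).
Proof.
rewrite /M2G_rvmx /mat2_entry !M2G_mulmxE /= !(linearDl, linearDr) /= !actA.
by congr (_, _); rewrite /= addrACA.
Qed.

(** The involution reverses products of matrices only over a commutative ring;
    under the action on G_1^2 it does so because commutators act as zero. *)
Lemma M2G_rvmx_symplecticM u P Q :
  M2G_rvmx u (symplectic (M2G_mulmx P Q)) =
  M2G_rvmx (M2G_rvmx u (symplectic Q)) (symplectic P).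
Proof.
rewrite /M2G_rvmx /mat2_entry !mxE /= !sum2E /mat2_entry.
rewrite !(linearDl, linearDr, linearNl, linearNr, opprD, opprK) /= !actA.
by congr (_, _); rewrite /= ![mul10 (mul10 _ (P _ _)) _]actC addrACA addrC.
Qed.

Lemma M2G_formMl u v P : M2G_form (M2G_rvmx u P) v = M2G_mulmx (M2G_form u v) P.
Proof.
apply: mat2P; rewrite M2G_mulmxE /M2G_rvmx /mat2_entry !mxE /=;
by rewrite !linearDl /= !formZ ?opprD ?linearNl /= !formC.
Qed.

(** The entries of B(u,v) are u_j c_i, where c is the column (-t, z) for
    v = (z, t), and replacing v by vP multiplies that column by P*. *)
Lemma M2G_formMr u v P : M2G_form u (M2G_rvmx v P) = M2G_mulmx (symplectic P) (M2G_form u v).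
Proof.
apply: mat2P; rewrite M2G_mulmxE /M2G_rvmx /mat2_entry !mxE /=;
by rewrite !linearDr /= !formZr ?(opprD, linearNl, linearNr, opprK) /= 1?addrC.
Qed.

Lemma M2G_mulmxDl P Q R : M2G_mulmx (P + Q) R = M2G_mulmx P R + M2G_mulmx Q R.
Proof.
by apply/matrixP=> i j; rewrite [RHS]mxE !M2G_mulmxE !mxE !linearDl /= addrACA.
Qed.

Lemma M2G_mulmxDr P Q R : M2G_mulmx R (P + Q) = M2G_mulmx R P + M2G_mulmx R Q.
Proof.
by apply/matrixP=> i j; rewrite [RHS]mxE !M2G_mulmxE !mxE !linearDr /= addrACA.
Qed.

Lemma M2G_rvmxDl u v P : M2G_rvmx (u + v) P = M2G_rvmx u P + M2G_rvmx v P.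
Proof. by congr (_, _); rewrite /= !linearDl /= addrACA. Qed.

Lemma M2G_rvmxDr u P Q : M2G_rvmx u (P + Q) = M2G_rvmx u P + M2G_rvmx u Q.
Proof.
by congr (_, _); rewrite /= /mat2_entry !mxE !linearDr /= addrACA.
Qed.

Lemma M2G_formDl u v w : M2G_form (u + v) w = M2G_form u w + M2G_form v w.
Proof. by apply: mat2P; rewrite !mxE /= linearDl ?opprD. Qed.

Lemma M2G_formDr u v w : M2G_form w (u + v) = M2G_form w u + M2G_form w v.
Proof. by apply: mat2P; rewrite !mxE /= linearDr ?opprD. Qed.

Lemma symplecticD (V : zmodType) (P Q : 'M[V]_2) :
  symplectic (P + Q) = symplectic P + symplectic Q.
Proof. by apply: mat2P; rewrite !mxE /= ?opprD. Qed.

Lemma symplecticK (V : zmodType) (P : 'M[V]_2) : symplectic (symplectic P) = P.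
Proof. by apply: mat2P; rewrite !mxE /= ?mxE ?opprK. Qed.

Lemma symplectic_form u v : symplectic (M2G_form u v) = M2G_form v u.
Proof.
by apply: mat2P; rewrite !mxE /= ?opprK (form_anti v.1, form_anti v.2) ?opprK.
Qed.

(** B(u,u) is a scalar matrix with a central entry: the off-diagonal entries are
    squares of odd elements. *)
Lemma M2G_form_diagC u P :
  M2G_mulmx (M2G_form u u) P = M2G_mulmx P (M2G_form u u).
Proof.
apply: mat2P; rewrite !M2G_mulmxE !mxE /= !form_alt ?oppr0;
  rewrite !(linear0l, linear0r) ?(addr0, add0r);
  by rewrite ?[mul11 u.2 u.1]form_anti linearNl linearNr /= formC.
Qed.

(** P + P* is the scalar matrix of the trace of P, and B has central entries. *)
Lemma M2G_form_trC u v P :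
  M2G_mulmx (M2G_form u v) (P + symplectic P) =
  M2G_mulmx (P + symplectic P) (M2G_form u v).
Proof.
apply: mat2P; rewrite !M2G_mulmxE !mxE /= !subrr;
  rewrite !(linear0l, linear0r) ?(addr0, add0r) ?linearNl ?linearNr /= formC //;
  by rewrite [P 1 1 + _]addrC.
Qed.

Lemma M2G_rvmx_trC u P Q :
  M2G_rvmx (M2G_rvmx u (P + symplectic P)) Q =
  M2G_rvmx (M2G_rvmx u Q) (P + symplectic P).
Proof.
rewrite /M2G_rvmx /mat2_entry !mxE /= !subrr !(linear0l, linear0r) ?(addr0, add0r).
by congr (_, _); rewrite /= [P 1 1 + _]addrC linearDl /= ![mul10 (mul10 _ (_ + _)) _]actC.
Qed.

(** The only part of alternativity that is not formal matrix calculus; each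
    coordinate is an instance of the cyclic identity. *)
Lemma M2G_rvmx_form_cyc u v :
  M2G_rvmx v (M2G_form u u) = M2G_rvmx u (M2G_form v u).
Proof.
have cyc z : mul10 u.1 (- mul11 z u.2) + mul10 u.2 (mul11 z u.1) =
    mul10 z (- mul11 u.1 u.2).
  rewrite -form_anti linearNr; apply/eqP.
  by rewrite -addr_eq0 [_ + mul10 z _]addrC addrA (Gamma_form_cyc laws).
rewrite /M2G_rvmx /mat2_entry !mxE /= !form_alt ?oppr0.
rewrite !(linear0l, linear0r) ?(addr0, add0r) !cyc.
by rewrite [mul11 u.2 u.1]form_anti.
Qed.

Lemma M2G_alternative : alternative_algebra (M2G G).
Proof.
have mulE P u Q v : ((P, u) : M2G G) ** (Q, v) =
  (M2G_mulmx P Q + M2G_form u v, M2G_rvmx v P + M2G_rvmx u (symplectic Q)) by [].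
move=> [P u] [Q v]; split; apply/eqP; rewrite subr_eq0; apply/eqP;
  rewrite !mulE; congr (_, _); rewrite /= -!(M2G_rvmxDr _ P, M2G_rvmxDr _ (symplectic P)).
(* Even and odd part of (X,X,Y), then of (Y,X,X): after expansion both sides
   are the same four terms, up to exchanging the two middle ones. *)
- rewrite !M2G_mulmxDl M2G_mulmxDr M2G_formMl M2G_formDr !M2G_formMr symplecticK.
  rewrite M2G_mulmxA M2G_form_trC M2G_mulmxDl M2G_form_diagC.
  by rewrite addrACA [M2G_mulmx Q _ + _]addrC.
- rewrite M2G_rvmx_trC symplecticD symplectic_form !M2G_rvmxDr M2G_rvmxDl.
  rewrite M2G_rvmx_symplecticM !M2G_rvmxA M2G_rvmx_form_cyc.
  by rewrite addrACA [M2G_rvmx u (M2G_form v u) + _]addrC.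
- rewrite M2G_mulmxDl M2G_mulmxDr M2G_formMr M2G_formDl !M2G_formMl.
  rewrite symplecticD symplecticK [symplectic P + P]addrC -M2G_form_trC M2G_mulmxDr.
  by rewrite M2G_mulmxA M2G_form_diagC addrACA.
- rewrite M2G_rvmx_trC symplecticD symplectic_form !M2G_rvmxDr M2G_rvmxDl.
  rewrite M2G_rvmx_symplecticM !M2G_rvmxA M2G_rvmx_form_cyc.
  by rewrite addrACA [M2G_rvmx u (M2G_form v u) + _]addrC.
Qed.

Lemma M2G_alternative_M2_algebra : alternative_M2_algebra (M2G G).
Proof.
split; first exact: M2G_alternative.
have [e [e1 e10]] := Gamma_one laws.
pose f (b : 'M[F]_2) : M2G G := (tens_coord_mx e b, 0).
have f_lin : linear (f : M2_algebra F -> M2G G).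
  move=> c b b'; rewrite /f linearPr; congr (_, _).
  by rewrite /= scaler0 addr0.
have fM b b' : f (b *m b') = f b ** f b'.
  congr (_, _); rewrite /= !M2G_0E //.
  apply/matrixP=> i j; rewrite M2G_mulmxE !mxE sum2E scalerDl.
  by rewrite !linearZl_LR !linearZr_LR !scalerA /= (e1 e).1.
exists (f 1%:M); split=> [[P u]|].
  have f1 : f 1%:M = (mx22 e 0 0 e, 0).
    by congr (_, _); apply: mat2P; rewrite !mxE /= ?(scale1r, scale0r).
  have rv1 v : M2G_rvmx v (mx22 e 0 0 e) = v.
    by rewrite /M2G_rvmx /mat2_entry !mxE /= !linear0r !e10 addr0 add0r -surjective_pairing.
  have sym1 : symplectic (mx22 e 0 0 e) = mx22 e 0 0 e.
    by apply: mat2P; rewrite !mxE /= ?mxE ?oppr0.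
  rewrite f1; split; congr (_, _); rewrite /= !M2G_0E ?sym1 //; apply/matrixP.
    apply: ord2P => j; rewrite M2G_mulmxE !mxE /= !linear0l ?addr0 ?add0r;
    exact: (e1 _).1.
  move=> i; apply: ord2P; rewrite M2G_mulmxE !mxE /= !linear0r ?addr0 ?add0r;
  exact: (e1 _).2.
pose fL : {linear M2_algebra F -> M2G G} := HB.pack f (GRing.isLinear.Build _ _ _ _ f f_lin).
by exists fL; split=> // b b'; apply: fM.
Qed.
End MatrixModelAlternative.

(** * Associators in alternative algebras *)

Section Opposite.
Variables (F : fieldType) (A : algebra F).

(** Left-right duality of the Peirce calculus is obtained by applying each lemma
   to the opposite algebra. *)
Definition opp_mul (x y : A) : A := y ** x.

Lemma opp_mul_bilinear : bilinear_for *:%R *:%R opp_mul.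
Proof. by split=> [y c x x'|x c y y'] /=; rewrite /opp_mul (linearPl, linearPr). Qed.
HB.instance Definition _ := bilinear_isBilinear.Build F A A A *:%R *:%R
  opp_mul opp_mul_bilinear.

Definition opp_algebra : algebra F := Algebra opp_mul.

Lemma opp_alternative : alternative_algebra A -> alternative_algebra opp_algebra.
Proof.
move=> altA x y; have [xxy yxx] := altA x y.
by split; rewrite /associator -opprB; apply/eqP; rewrite oppr_eq0; apply/eqP.
Qed.
End Opposite.

Section Alternative.
Variables (F : fieldType) (A : algebra F).
Hypothesis altA : alternative_algebra A.
Implicit Types x y z w a : A.

Lemma associatorDl x y z w :
  associator (x + y) z w = associator x z w + associator y z w.
Proof. by rewrite /associator !linearDl /= opprD addrACA. Qed.
Lemma associatorDm x y z w :
  associator z (x + y) w = associator z x w + associator z y w.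
Proof. by rewrite /associator linearDl linearDr !linearDl linearDr /= opprD addrACA. Qed.
Lemma associatorDr x y z w :
  associator z w (x + y) = associator z w x + associator z w y.
Proof. by rewrite /associator !linearDr /= opprD addrACA. Qed.

Lemma associator_swapl x y z : associator x y z = - associator y x z.
Proof.
apply/eqP; rewrite -addr_eq0; apply/eqP; have [+ _] := altA (x + y) z.
rewrite associatorDl !associatorDm.
by have [-> _] := altA x z; have [-> _] := altA y z; rewrite addr0 add0r.
Qed.

Lemma associator_swapr x y z : associator x y z = - associator x z y.
Proof.
apply/eqP; rewrite -addr_eq0; apply/eqP; have [_ +] := altA (y + z) x.
rewrite associatorDr !associatorDm.
have [_ ->] := altA y x; have [_ ->] := altA z x; rewrite addr0 add0r.
by rewrite addrC.
Qed.

Lemma associator_cycle x y z : associator x y z = associator y z x.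
Proof. by rewrite associator_swapl associator_swapr opprK. Qed.

Lemma teichmuller w x y z :
  associator (w ** x) y z - associator w (x ** y) z + associator w x (y ** z) =
  w ** associator x y z + associator w x y ** z.
Proof.
rewrite /associator linearBr linearBl /= opprB.
by rewrite addrAC [X in X + _]addrA addrNK addrC addrACA [- _ - _]addrC addrACA.
Qed.

(** Equivalent to the left Moufang identity.  The Teichmuller identity for
    (a,x,x,y), with (x^2,a,y) and (x^2,y,a) expanded by the same identity,
    leaves exactly this. *)
Lemma associator_mull x a y : associator x (a ** x) y = x ** associator x a y.
Proof.
have sq b c : associator (x ** x) b c = associator x (x ** b) c + x ** associator x b c.
  have := teichmuller x x b c; have [-> _] := altA x (b ** c).
  have [-> _] := altA x b; rewrite linear0l !addr0 => <-.
  by rewrite addrC addrNK.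
have := teichmuller a x x y; have [-> _] := altA x y.
have [_ ->] := altA x a; rewrite linear0l linear0r addr0.
rewrite associator_swapl [associator a (x ** x) y]associator_swapl opprK.
rewrite [associator a x _]associator_cycle => eq0.
have := sq y a; rewrite associator_swapr [associator x y a]associator_swapr => eq1.
have e : associator x (x ** y) a =
    - associator (x ** x) a y + x ** associator x a y.
  by rewrite eq1 linearNr /= addrNK.
by move: eq0; rewrite e addrA addrK addrC => /subr0_eq.
Qed.
End Alternative.

(** * Peirce components *)

Section Peirce.
Variables (F : fieldType) (A : algebra F) (E : bool -> A).

(** The two idempotents are indexed by booleans, so that a statement about
    indices i != j covers both orientations at once. *)
Definition complementary_idempotents :=
  is_identity (E true + E false) /\ forall i, E i ** E i = E i.

Definition peirce i j (x : A) := E i ** x = x /\ x ** E j = x.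

Hypothesis altA : alternative_algebra A.
Hypothesis EP : complementary_idempotents.

Let idemE i : E i ** E i = E i.
Proof. exact: EP.2. Qed.

Lemma idem_left i j x : i != j -> E i ** x + E j ** x = x.
Proof.
have [+ _] := EP.1 x; rewrite linearDl /=.
by case: i j => -[] // xE _; rewrite // addrC.
Qed.
Lemma idem_right i j x : i != j -> x ** E i + x ** E j = x.
Proof.
have [_ +] := EP.1 x; rewrite linearDr /=.
by case: i j => -[] // xE _; rewrite // addrC.
Qed.

Lemma idem_left0 i j x : i != j -> E i ** x = 0 <-> E j ** x = x.
Proof.
move=> ij; split=> h; first by rewrite -[RHS](idem_left x ij) h add0r.
by apply: (addIr (E j ** x)); rewrite (idem_left x ij) h add0r.
Qed.
Lemma idem_right0 i j x : i != j -> x ** E i = 0 <-> x ** E j = x.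
Proof.
move=> ij; split=> h; first by rewrite -[RHS](idem_right x ij) h add0r.
by apply: (addIr (x ** E j)); rewrite (idem_right x ij) h add0r.
Qed.

Lemma peirce_left0 i j k x : i != j -> peirce j k x -> E i ** x = 0.
Proof. by move=> ij [h _]; apply/(idem_left0 _ ij). Qed.
Lemma peirce_right0 i j k x : i != j -> peirce k j x -> x ** E i = 0.
Proof. by move=> ij [_ h]; apply/(idem_right0 _ ij). Qed.

Lemma associator_compl i j x y :
  i != j -> associator (E i) x y = - associator (E j) x y.
Proof.
move=> ij; apply/eqP; rewrite -addr_eq0 -associatorDl /associator.
have h z : (E i + E j) ** z = z by rewrite linearDl idem_left.
by rewrite !h subrr.
Qed.

Lemma peirceB i j x y : peirce i j x -> peirce i j y -> peirce i j (x - y).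
Proof. by move=> [h1 h2] [h3 h4]; split; rewrite (linearBr, linearBl) ?h1 ?h2 /= ?h3 ?h4. Qed.

Lemma associator_idem i j x : associator (E i) (E j) x = 0.
Proof.
have [<-|ij] := eqVneq i j; first exact: (altA _ _).1.
by rewrite (associator_compl _ _ ij) (altA _ _).1 oppr0.
Qed.

Lemma peirce_component i j x : peirce i j (E i ** x ** E j).
Proof.
have ix : E i ** (E i ** x) = E i ** x.
  by have /subr0_eq := (altA (E i) x).1; rewrite idemE.
split; last by have /subr0_eq := (altA (E j) (E i ** x)).2; rewrite idemE.
have : associator (E i) (E i ** x) (E j) = 0.
  by rewrite associator_swapr // associator_idem oppr0.
by move/subr0_eq; rewrite ix.
Qed.

Lemma peirce_decomposition x :
  x = E true ** x ** E true + E true ** x ** E false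
      + (E false ** x ** E true + E false ** x ** E false).
Proof. by rewrite !idem_right // idem_left. Qed.

(** The middle idempotent associates with both factors, hence so does its
    complement; this drives the product rule A_ij A_jk <= A_ik. *)
Lemma peirce_middle_associator0 i j k l x y :
  peirce i j x -> peirce j k y -> associator (E l) x y = 0.
Proof.
move=> [_ xj] [jy _].
have h : associator (E j) x y = 0.
  by rewrite associator_swapl // /associator xj jy subrr oppr0.
by have [-> //|lj] := eqVneq l j; rewrite (associator_compl _ _ lj) h oppr0.
Qed.

Lemma peirce_mul i j k x y :
  peirce i j x -> peirce j k y -> peirce i k (x ** y).
Proof.
move=> xP yP; have h l := peirce_middle_associator0 l xP yP; have [ix _] := xP.
have [_ yk] := yP; split.
  by have /subr0_eq := h i; rewrite ix.
have : associator x y (E k) = 0 by rewrite associator_cycle // associator_cycle ?h.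
by move/subr0_eq; rewrite yk.
Qed.

(** With e = E i, alternativity turns (x,e,y) = xy into (e,x,y) = -xy, and
    [associator_mull] makes (e,x,y) fixed by e, so e(xy) = xy.  But then
    (e,x,y) = (ex)y - e(xy) = 0. *)
Lemma peirce_diag_mul0 i j k x y :
  i != j -> peirce i i x -> peirce j k y -> x ** y = 0.
Proof.
move=> ij [ix xi] yP.
have xey : associator (E i) x y = - (x ** y).
  by rewrite associator_swapl // /associator xi (peirce_left0 ij yP) linear0r subr0.
have exy : E i ** (x ** y) = x ** y.
  by have := associator_mull altA (E i) x y; rewrite xi xey linearNr => /oppr_inj.
by apply: oppr_inj; rewrite -xey /associator ix exy subrr oppr0.
Qed.

(** With e = E i, (e,x,y) = -(x,e,y) = xy and (e,x,y) = xy - e(xy), so e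
    annihilates xy. *)
Lemma peirce_skew_left i j x y :
  i != j -> peirce i j x -> peirce i j y -> E j ** (x ** y) = x ** y.
Proof.
move=> ij xP [iy _]; apply/(idem_left0 _ ij).
have [ix _] := xP; have: associator (E i) x y = x ** y.
  by rewrite associator_swapl // /associator iy (peirce_right0 ij xP) linear0l sub0r opprK.
rewrite /associator ix => h; apply/eqP; rewrite -oppr_eq0; apply/eqP.
by apply: (addrI (x ** y)); rewrite h addr0.
Qed.

Lemma peirce_square0 i j x : i != j -> peirce i j x -> x ** x = 0.
Proof.
move=> ij xP; have := (altA x (E i)).2; rewrite /associator xP.1.
by have /(idem_left0 _ ij) -> := peirce_skew_left ij xP xP; rewrite subr0.
Qed.

Lemma peirce_anticomm i j x y :
  i != j -> peirce i j x -> peirce i j y -> x ** y = - (y ** x).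
Proof.
move=> ij xP yP; apply/eqP; rewrite -addr_eq0; apply/eqP.
have xyP : peirce i j (x + y).
  by split; rewrite (linearDr, linearDl) /= ?xP.1 ?yP.1 ?xP.2 ?yP.2.
have := peirce_square0 ij xyP; rewrite linearDl !linearDr /=.
by rewrite (peirce_square0 ij xP) (peirce_square0 ij yP) addr0 add0r.
Qed.
End Peirce.

Section OppositePeirce.
Variables (F : fieldType) (A : algebra F) (E : bool -> A).

Lemma opp_complementary : complementary_idempotents E ->
  @complementary_idempotents F (opp_algebra A) E.
Proof. by move=> [oneE idemE]; split=> // z; have [] := oneE z. Qed.

Lemma opp_peirce i j x : peirce E i j x -> @peirce F (opp_algebra A) E j i x.
Proof. by case. Qed.

Hypothesis altA : alternative_algebra A.
Hypothesis EP : complementary_idempotents E.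

Lemma peirce_mul_diag0 i j k x y :
  j != k -> peirce E i j x -> peirce E k k y -> x ** y = 0.
Proof.
rewrite eq_sym => kj /opp_peirce xP /opp_peirce yP.
exact: (peirce_diag_mul0 (opp_alternative altA) (opp_complementary EP) kj yP xP).
Qed.

Lemma peirce_skew i j x y :
  i != j -> peirce E i j x -> peirce E i j y -> peirce E j i (x ** y).
Proof.
move=> ij xP yP; split; first exact: (peirce_skew_left altA EP ij xP yP).
rewrite eq_sym in ij; move: xP yP => /opp_peirce xP /opp_peirce yP.
exact: (peirce_skew_left (opp_alternative altA) (opp_complementary EP) ij yP xP).
Qed.
End OppositePeirce.

Lemma associator0 (F : fieldType) (A : algebra F) (x y z : A) :
  associator x y z = 0 -> x ** (y ** z) = x ** y ** z.
Proof. by move/subr0_eq. Qed.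

Section PeirceAssociativity.
Variables (F : fieldType) (A : algebra F) (E : bool -> A).
Hypothesis altA : alternative_algebra A.
Hypothesis EP : complementary_idempotents E.
Variables (i j : bool).
Hypothesis ij : i != j.
Notation P := (peirce E).
Implicit Types a b x y w d : A.

Let ji : j != i. Proof. by rewrite eq_sym. Qed.
Let diag0 i j k x y := @peirce_diag_mul0 F A E altA EP i j k x y.
Let mul_diag0 i j k x y := @peirce_mul_diag0 F A E altA EP i j k x y.

(** The next three associators vanish because some cyclic or transposed
    rearrangement of the factors has both of its terms equal to zero. *)
Lemma peirce_ass_iij a b x :
  P i i a -> P i i b -> P i j x -> associator a b x = 0.
Proof.
move=> aP bP xP; rewrite associator_cycle // associator_cycle // /associator.
rewrite (mul_diag0 ji xP aP) (mul_diag0 ji xP (peirce_mul altA EP aP bP)).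
by rewrite linear0l subr0.
Qed.

Lemma peirce_ass_iji a x w :
  P i i a -> P i j x -> P j i w -> associator a x w = 0.
Proof.
move=> aP xP wP; rewrite associator_swapl // /associator (mul_diag0 ji xP aP).
by rewrite (diag0 ij aP wP) linear0l linear0r subr0 oppr0.
Qed.

Lemma peirce_ass_jii w a b :
  P j i w -> P i i a -> P i i b -> associator w a b = 0.
Proof.
move=> wP aP bP; rewrite associator_cycle // /associator.
rewrite (diag0 ij bP wP) (diag0 ij (peirce_mul altA EP aP bP) wP).
by rewrite linear0r subr0.
Qed.

(** With [peirce_skew_mulC]: A_11 moves freely through the skew product of
    A_12 x A_12 -> A_21, by comparing (a,x,y) with (x,a,y) and with (x,y,a), in
    each of which one term is zero. *)
Lemma peirce_skew_mulA a x y :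
  P i i a -> P i j x -> P i j y -> a ** x ** y = x ** (a ** y).
Proof.
move=> aP xP yP; have := associator_swapl altA a x y.
rewrite /associator (mul_diag0 ji xP aP) (diag0 ij aP (peirce_skew altA EP ij xP yP)).
by rewrite linear0l subr0 sub0r opprK.
Qed.

Lemma peirce_skew_mulC a x y :
  P i i a -> P i j x -> P i j y -> a ** x ** y = x ** y ** a.
Proof.
move=> aP xP yP; have := associator_cycle altA a x y.
rewrite /associator (mul_diag0 ji yP aP) (diag0 ij aP (peirce_skew altA EP ij xP yP)).
by rewrite linear0r !subr0.
Qed.

End PeirceAssociativity.

Section PeirceAssociativityOpposite.
Variables (F : fieldType) (A : algebra F) (E : bool -> A).
Hypothesis altA : alternative_algebra A.
Hypothesis EP : complementary_idempotents E.
Variables (i j : bool).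
Hypothesis ij : i != j.

Lemma skew_peirce_mulA a w w' : peirce E i i a -> peirce E j i w ->
  peirce E j i w' -> w' ** (w ** a) = w' ** a ** w.
Proof.
move=> /opp_peirce aP /opp_peirce wP /opp_peirce wP'.
exact: (peirce_skew_mulA (opp_alternative altA) (opp_complementary EP) ij aP wP wP').
Qed.

Lemma skew_peirce_mulC a w w' : peirce E i i a -> peirce E j i w ->
  peirce E j i w' -> w' ** (w ** a) = a ** (w' ** w).
Proof.
move=> /opp_peirce aP /opp_peirce wP /opp_peirce wP'.
exact: (peirce_skew_mulC (opp_alternative altA) (opp_complementary EP) ij aP wP wP').
Qed.
End PeirceAssociativityOpposite.

(** * Multiplication table relative to matrix units *)

(** Here E true, u, v, E false play e_11, e_12, e_21, e_22.  An element of A_11 is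
    carried to the other components as b u, v c and v(d u); an odd element x lies
    in A_12, and u x is its copy in A_21.  In the names of the products below,
    [unit_ij] is the copy of A_11 in the component A_ij, [odd12] is the odd space
    and [odd21] its image under left multiplication by u. *)

Section MatrixUnits.
Variables (F : fieldType) (A : algebra F) (E : bool -> A) (u v : A).
Hypothesis altA : alternative_algebra A.
Hypothesis EP : complementary_idempotents E.
Notation A11 := (peirce E true true).
Notation A12 := (peirce E true false).
Notation A21 := (peirce E false true).
Notation A22 := (peirce E false false).
Hypotheses (uP : A12 u) (vP : A21 v).
Hypotheses (uv : u ** v = E true) (vu : v ** u = E false).
Implicit Types a b c x y z w d : A.

Let tf : true != false. Proof. by []. Qed.
Let ft : false != true. Proof. by []. Qed.
Let mulP i j k x y : peirce E i j x -> peirce E j k y -> peirce E i k (x ** y).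
Proof. exact: (@peirce_mul F A E altA EP). Qed.
Let diag0 i j k x y : i != j -> peirce E i i x -> peirce E j k y -> x ** y = 0.
Proof. exact: (@peirce_diag_mul0 F A E altA EP). Qed.
Let mul_diag0 i j k x y :
  j != k -> peirce E i j x -> peirce E k k y -> x ** y = 0.
Proof. exact: (@peirce_mul_diag0 F A E altA EP). Qed.
Let skewP i j x y :
  i != j -> peirce E i j x -> peirce E i j y -> peirce E j i (x ** y).
Proof. exact: (@peirce_skew F A E altA EP). Qed.
Let anticomm i j x y :
  i != j -> peirce E i j x -> peirce E i j y -> x ** y = - (y ** x).
Proof. exact: (@peirce_anticomm F A E altA EP). Qed.
Let cycle := associator_cycle altA.
Let idemP i : peirce E i i (E i).
Proof. by split; apply: EP.2. Qed.
Let uu : u ** u = 0. Proof. exact: (peirce_square0 altA EP tf uP). Qed.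
Let uux x : u ** (u ** x) = 0.
Proof. by have /subr0_eq <- := (altA u x).1; rewrite uu linear0l. Qed.
Let vv : v ** v = 0. Proof. exact: (peirce_square0 altA EP ft vP). Qed.

Let ass_11_12 a b x : A11 a -> A11 b -> A12 x -> a ** (b ** x) = a ** b ** x.
Proof. by move=> aP bP xP; apply/associator0/(peirce_ass_iij altA EP tf). Qed.
Let ass_21_11 w a b : A21 w -> A11 a -> A11 b -> w ** (a ** b) = w ** a ** b.
Proof. by move=> wP aP bP; apply/associator0/(peirce_ass_jii altA EP tf). Qed.
Let ass_11_12_21 a x w : A11 a -> A12 x -> A21 w -> a ** (x ** w) = a ** x ** w.
Proof. by move=> aP xP wP; apply/associator0/(peirce_ass_iji altA EP tf). Qed.
Let ass_12_21_11 x w a : A12 x -> A21 w -> A11 a -> x ** (w ** a) = x ** w ** a.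
Proof.
by move=> xP wP aP; apply/associator0; rewrite -cycle; apply: (peirce_ass_iji altA EP tf).
Qed.
Let ass_21_11_12 w a x : A21 w -> A11 a -> A12 x -> w ** (a ** x) = w ** a ** x.
Proof.
by move=> wP aP xP; apply/associator0; rewrite cycle; apply: (peirce_ass_iji altA EP tf).
Qed.
Let ass_21_12_22 w x d : A21 w -> A12 x -> A22 d -> w ** (x ** d) = w ** x ** d.
Proof.
by move=> wP xP dP; apply/associator0; rewrite -cycle; apply: (peirce_ass_iji altA EP ft).
Qed.
Let skew_mulA a x y : A11 a -> A12 x -> A12 y -> a ** x ** y = x ** (a ** y).
Proof. exact: (@peirce_skew_mulA F A E altA EP true false tf). Qed.
Let skew_mulC a x y : A11 a -> A12 x -> A12 y -> a ** x ** y = x ** y ** a.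
Proof. exact: (@peirce_skew_mulC F A E altA EP true false tf). Qed.
Let mulA_skew a w w' : A11 a -> A21 w -> A21 w' -> w' ** (w ** a) = w' ** a ** w.
Proof. exact: (@skew_peirce_mulA F A E altA EP true false tf). Qed.
Let mulC_skew a w w' : A11 a -> A21 w -> A21 w' -> w' ** (w ** a) = a ** (w' ** w).
Proof. exact: (@skew_peirce_mulC F A E altA EP true false tf). Qed.

Lemma unit_12_12 a b : A11 a -> A11 b -> (a ** u) ** (b ** u) = 0.
Proof.
move=> aP bP; rewrite (skew_mulC aP uP (mulP bP uP)).
by rewrite -(skew_mulA bP uP uP) (skew_mulC bP uP uP) uu !linear0l.
Qed.

Lemma unit_12_21 a b : A11 a -> A11 b -> (a ** u) ** (v ** b) = a ** b.
Proof.
move=> aP bP; rewrite -(ass_11_12_21 aP uP (mulP vP bP)).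
by rewrite (ass_12_21_11 uP vP bP) uv bP.1.
Qed.

(** Exchanging the last two factors of the associator of a u, v, b u
    gives a product of two copies of A_11 in A_12, which is zero, and a
    product A_12 A_11. *)
Lemma unit_12_22 a b : A11 a -> A11 b -> (a ** u) ** (v ** (b ** u)) = a ** b ** u.
Proof.
move=> aP bP; have buP := mulP bP uP; have auP := mulP aP uP.
have: associator (a ** u) v (b ** u) = 0.
  rewrite associator_swapr // /associator unit_12_12 // linear0l.
  by rewrite (mul_diag0 ft auP (mulP buP vP)) subrr oppr0.
by move/associator0->; rewrite -(ass_11_12_21 aP uP vP) uv aP.2 (ass_11_12 aP bP uP).
Qed.

Lemma unit_21_12 a b : A11 a -> A11 b -> (v ** a) ** (b ** u) = v ** (a ** b ** u).
Proof.
by move=> aP bP; rewrite -(ass_21_11_12 vP aP (mulP bP uP)) (ass_11_12 aP bP uP).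
Qed.

Lemma unit_21_21 a b : A11 a -> A11 b -> (v ** a) ** (v ** b) = 0.
Proof.
move=> aP bP; rewrite (mulC_skew bP vP (mulP vP aP)).
by rewrite -(mulA_skew aP vP vP) (mulC_skew aP vP vP) vv !linear0r.
Qed.

Lemma unit_22_21 a b : A11 a -> A11 b -> (v ** (a ** u)) ** (v ** b) = v ** (a ** b).
Proof.
move=> aP bP; have vbP := mulP vP bP; have auP := mulP aP uP.
have: associator v (a ** u) (v ** b) = 0.
  rewrite associator_swapr // /associator (mulC_skew bP vP vP) vv linear0r linear0l.
  by rewrite (mul_diag0 tf vP (mulP vbP auP)) subrr oppr0.
by move/associator0<-; rewrite unit_12_21.
Qed.

Lemma unit_22_22 a b : A11 a -> A11 b ->
  (v ** (a ** u)) ** (v ** (b ** u)) = v ** (a ** b ** u).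
Proof.
move=> aP bP; have auP := mulP aP uP; have dP := mulP vP (mulP bP uP).
by rewrite -ass_21_12_22 // unit_12_22.
Qed.

(** A_11 alone carries no reason to be associative; the matrix units do, by
    writing abc as the product of elements of A_11, A_12 and A_21. *)
Lemma peirce11_assoc a b c : A11 a -> A11 b -> A11 c -> a ** b ** c = a ** (b ** c).
Proof.
move=> aP bP cP; rewrite -(unit_12_21 (mulP aP bP) cP) -(ass_11_12 aP bP uP).
by rewrite -ass_11_12_21 ?unit_12_21 //; apply: mulP; eassumption.
Qed.

(** The form u(xy) is also -x(uy); the first expression shows how A_11 acts on
    its right, the second how it acts on its left. *)
Lemma unit_form_neg x y : A12 x -> A12 y -> x ** (u ** y) = - (u ** (x ** y)).
Proof.
move=> xP yP; have := associator_swapl altA x u y; rewrite /associator.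
rewrite (anticomm tf xP uP) linearNl /= opprD opprK => /addrI <-.
by rewrite opprK.
Qed.

Lemma unit_form_mull a x y : A11 a -> A12 x -> A12 y ->
  u ** (a ** x ** y) = a ** (u ** (x ** y)).
Proof.
move=> aP xP yP; have axP := mulP aP xP; apply: oppr_inj.
rewrite -unit_form_neg // -linearNr /= -unit_form_neg //.
by rewrite (ass_11_12_21 aP xP (skewP tf uP yP)).
Qed.

Lemma unit_form_mulr a x y : A11 a -> A12 x -> A12 y ->
  u ** (a ** x ** y) = u ** (x ** y) ** a.
Proof.
move=> aP xP yP; rewrite skew_mulC //.
by rewrite (ass_12_21_11 uP (skewP tf xP yP) aP).
Qed.

(** The part of A_12 on which M_2(F) acts as on the Cayley bimodule: for x in the
    other summand A_11 u, the product x v recovers the coefficient. *)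
Definition odd_peirce x := A12 x /\ x ** v = 0.

Lemma odd_mull a x : A11 a -> odd_peirce x -> odd_peirce (a ** x).
Proof.
move=> aP [xP xv]; split; first exact: mulP aP xP.
by rewrite -(ass_11_12_21 aP xP vP) xv linear0r.
Qed.

Lemma odd_unit_mulr x : odd_peirce x -> u ** x ** v = - x.
Proof.
move=> [xP xv]; have := cycle u x v; rewrite /associator xv vu linear0r linear0l.
by rewrite xP.2 subr0 sub0r.
Qed.

(** v x lies in A_22, hence equals (vu)(vx) = v(u(vx)), and u(vx) is
    (uv)x - (u,v,x) = x + (ux)v = 0. *)
Lemma odd_unit_left0 x : odd_peirce x -> v ** x = 0.
Proof.
move=> xO; have [xP xv] := xO; have dP := mulP vP xP.
rewrite -dP.1 -vu -ass_21_12_22 //.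
have := associator_swapr altA u x v; rewrite /associator odd_unit_mulr // xv linear0r.
rewrite uv xP.1 subr0 opprB => /esym/eqP; rewrite subr_eq addNr => /eqP ->.
by rewrite linear0r.
Qed.

Lemma odd_unit_mull x : odd_peirce x -> v ** (u ** x) = x.
Proof.
move=> xO; have [xP _] := xO.
by rewrite (anticomm ft vP (skewP tf uP xP)) odd_unit_mulr // opprK.
Qed.

(** After left multiplication by u, which is injective on the odd space, the
    action becomes right multiplication: u(cx) = (ux)c.  So it is
    an action of A_11 and of its opposite at once. *)
Lemma odd_mulC a b x : A11 a -> A11 b -> odd_peirce x -> a ** b ** x = b ** a ** x.
Proof.
move=> aP bP xO; have [xP _] := xO; have abP := mulP aP bP; have baP := mulP bP aP.
have uxP := skewP tf uP xP.
have h c : A11 c -> u ** (c ** x) = u ** x ** c.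
  by move=> cP; rewrite -skew_mulA // skew_mulC.
rewrite -(odd_unit_mull (odd_mull abP xO)) -(odd_unit_mull (odd_mull baP xO)).
congr (v ** _); rewrite (h _ abP) (ass_21_11 uxP aP bP) -(h _ aP).
have axP := mulP aP xP.
by rewrite -(skew_mulC bP uP axP) (skew_mulA bP uP axP) (ass_11_12 bP aP xP).
Qed.

Lemma unit_12_odd21 b x : A11 b -> A12 x -> (b ** u) ** (u ** x) = 0.
Proof.
move=> bP xP; rewrite (unit_form_neg (mulP bP uP) xP).
by rewrite (skew_mulA bP uP xP) uux oppr0.
Qed.

Lemma odd21_unit_12 b x : A11 b -> A12 x -> (u ** x) ** (b ** u) = 0.
Proof.
move=> bP xP; have buP := mulP bP uP.
have: associator u x (b ** u) = associator (b ** u) u x by rewrite [RHS]cycle.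
rewrite /associator unit_12_odd21 // (skew_mulC bP uP uP) uu !linear0l subr0.
by rewrite (anticomm tf xP buP) (skew_mulA bP uP xP) linearNr /= uux oppr0 subr0.
Qed.

Lemma unit_21_odd12 c x : A11 c -> odd_peirce x -> (v ** c) ** x = 0.
Proof.
move=> cP xO; rewrite -(ass_21_11_12 vP cP xO.1).
exact/odd_unit_left0/odd_mull.
Qed.

Lemma odd21_mulr a x : A11 a -> A12 x -> (u ** x) ** a = u ** (a ** x).
Proof. by move=> aP xP; rewrite -(skew_mulA aP uP xP) (skew_mulC aP uP xP). Qed.

Lemma unit_21_odd21 c x : A11 c -> odd_peirce x -> (v ** c) ** (u ** x) = c ** x.
Proof.
move=> cP xO; have uxP := skewP tf uP xO.1.
by rewrite -(mulA_skew cP uxP vP) (mulC_skew cP uxP vP) odd_unit_mull.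
Qed.

(** The associator (v, du, ux) equals its rotation (du, ux, v), whose first term
    vanishes because (du)(ux) does. *)
Lemma unit_22_odd21 d x : A11 d -> odd_peirce x ->
  (v ** (d ** u)) ** (u ** x) = u ** (d ** x).
Proof.
move=> dP xO; have duP := mulP dP uP; have := cycle v (d ** u) (u ** x).
rewrite /associator (unit_12_odd21 dP xO.1) linear0r linear0l subr0 sub0r => ->.
by rewrite odd_unit_mulr // linearNr /= opprK (skew_mulA dP uP xO.1).
Qed.

Lemma odd12_unit_12 b x : A11 b -> A12 x -> x ** (b ** u) = - (u ** (b ** x)).
Proof.
by move=> bP xP; rewrite (anticomm tf xP (mulP bP uP)) (skew_mulA bP uP xP).
Qed.

Lemma odd12_unit_21 c x : A11 c -> odd_peirce x -> x ** (v ** c) = 0.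
Proof.
by move=> cP [xP xv]; rewrite (ass_12_21_11 xP vP cP) xv linear0l.
Qed.

Lemma odd21_unit_21 c x : A11 c -> odd_peirce x -> (u ** x) ** (v ** c) = - (c ** x).
Proof.
move=> cP xO; have uxP := skewP tf uP xO.1.
by rewrite (anticomm ft uxP (mulP vP cP)) unit_21_odd21.
Qed.

Lemma odd12_unit_22 d x : A11 d -> odd_peirce x -> x ** (v ** (d ** u)) = d ** x.
Proof.
move=> dP xO; have [xP xv] := xO; have duP := mulP dP uP.
have := cycle x v (d ** u); rewrite /associator xv linear0l.
rewrite (diag0 ft (mulP vP duP) xP) !sub0r (skew_mulA dP uP xP).
by rewrite (odd_unit_mull (odd_mull dP xO)) => /oppr_inj.
Qed.

(** For w in A_21 one has w - v(uw) = (v,u,w) = (w,v,u) = (wv)u, and for w = xy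
    with x and y odd, wv = (x,y,v) = (y,v,x) = 0. *)
Lemma odd12_odd12 x y : odd_peirce x -> odd_peirce y -> v ** (u ** (x ** y)) = x ** y.
Proof.
move=> xO yO; have [xP xv] := xO; have [yP yv] := yO.
have xyP := skewP tf xP yP.
have xyv : x ** y ** v = 0.
  have := cycle x y v; rewrite /associator yv (odd_unit_left0 xO).
  by rewrite !linear0r !linear0l !subr0.
have := cycle (x ** y) v u; rewrite /associator xyv linear0l vu xyP.1.
by rewrite (mul_diag0 tf xyP (idemP false)) subrr => /esym/subr0_eq.
Qed.

Lemma odd21_odd12 x y : odd_peirce x -> odd_peirce y ->
  (u ** x) ** y = v ** (u ** (x ** y) ** u).
Proof.
move=> xO yO; have [xP _] := xO; have [yP _] := yO.
have xyP := skewP tf xP yP; have pP := mulP uP xyP.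
rewrite (ass_21_11_12 vP pP uP) odd12_odd12 //.
have := cycle u x y; rewrite /associator (anticomm tf yP uP) linearNr /=.
by rewrite unit_form_neg // opprK => /addIr.
Qed.

Lemma odd21_odd21 x y : A12 x -> A12 y -> (u ** x) ** (u ** y) = - (u ** (x ** y) ** u).
Proof.
move=> xP yP; have uyP := skewP tf uP yP; have xuyP := mulP xP uyP.
have uyu : u ** y ** u = 0.
  rewrite (anticomm tf uP yP) linearNl /=; apply/eqP; rewrite oppr_eq0; apply/eqP.
  by have := (altA u y).2; rewrite /associator uu linear0r subr0.
have := cycle u x (u ** y); rewrite /associator uyu (mul_diag0 ft uP xuyP).
by rewrite linear0r !subr0 (unit_form_neg xP yP) linearNl.
Qed.

(** Compute (xy)(uz) in two ways: by the table it is <x,y>z, and it is the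
    associator (x,y,uz), whose rotation (y,uz,x) is -<y,z>x - <z,x>y. *)
Lemma odd_cyclic x y z : odd_peirce x -> odd_peirce y -> odd_peirce z ->
  u ** (x ** y) ** z + u ** (y ** z) ** x + u ** (z ** x) ** y = 0.
Proof.
move=> xO yO zO; have [[xP _] [yP _] [zP _]] := And3 xO yO zO.
have pP x' y' (x'P : A12 x') (y'P : A12 y') := mulP uP (skewP tf x'P y'P).
have uzP := skewP tf uP zP.
have := cycle x y (u ** z); rewrite /associator (mul_diag0 ft xP (mulP yP uzP)) subr0.
rewrite -{1}(odd12_odd12 xO yO) (unit_21_odd21 (pP _ _ xP yP) zO) => ->.
rewrite (odd21_odd12 zO xO) (odd12_unit_22 (pP _ _ zP xP) yO) unit_form_neg //.
by rewrite linearNl /= [X in X + _]addrC addrA subrr add0r addNr.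
Qed.

Definition peirce_sum a b c d x y : A :=
  a + b ** u + v ** c + v ** (d ** u) + (x + u ** y).

Lemma peirce_sum_mul a b c d x y a' b' c' d' z t :
  A11 a -> A11 b -> A11 c -> A11 d -> odd_peirce x -> odd_peirce y ->
  A11 a' -> A11 b' -> A11 c' -> A11 d' -> odd_peirce z -> odd_peirce t ->
  peirce_sum a b c d x y ** peirce_sum a' b' c' d' z t =
  peirce_sum (a ** a' + b ** c' - u ** (x ** t)) (a ** b' + b ** d' - u ** (y ** t))
    (c ** a' + d ** c' + u ** (x ** z)) (c ** b' + d ** d' + u ** (y ** z))
    (a ** z + c ** t + (d' ** x - c' ** y)) (b ** z + d ** t + (- (b' ** x) + a' ** y)).
Proof.
move=> aP bP cP dP xO yO a'P b'P c'P d'P zO tO.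
have [[xP _] [yP _]] := (conj xO yO); have [[zP _] [tP _]] := (conj zO tO).
have [buP b'uP] := conj (mulP bP uP) (mulP b'P uP).
have [vcP vc'P] := conj (mulP vP cP) (mulP vP c'P).
have [duP d'uP] := conj (mulP vP (mulP dP uP)) (mulP vP (mulP d'P uP)).
have [uyP utP] := conj (skewP tf uP yP) (skewP tf uP tP).
rewrite /peirce_sum !(linearDl, linearDr, linearNl, linearNr) /= !addrA.
(* Of the 36 products of homogeneous terms 16 vanish; the remaining 20 are
   brought into the order of the right-hand side by the last step. *)
rewrite (ass_11_12 aP b'P uP) (diag0 tf aP vc'P) (diag0 tf aP d'uP) (diag0 tf aP utP).
rewrite (mul_diag0 ft buP a'P) (unit_12_12 bP b'P) (unit_12_21 bP c'P).
rewrite (unit_12_22 bP d'P) (skew_mulA bP uP zP) (unit_12_odd21 bP tP).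
rewrite -(ass_21_11 vP cP a'P) (unit_21_12 cP b'P) (unit_21_21 cP c'P).
rewrite (mul_diag0 tf vcP d'uP) (unit_21_odd12 cP zO) (unit_21_odd21 cP tO).
rewrite (diag0 ft duP a'P) (diag0 ft duP b'uP) (unit_22_21 dP c'P).
rewrite (unit_22_22 dP d'P) (diag0 ft duP zP) (unit_22_odd21 dP tO).
rewrite (mul_diag0 ft xP a'P) (odd12_unit_12 b'P xP) (odd12_unit_21 c'P xO).
rewrite (odd12_unit_22 d'P xO) (unit_form_neg xP tP).
rewrite (odd21_mulr a'P yP) (odd21_unit_12 b'P yP) (odd21_unit_21 c'P yO).
rewrite (mul_diag0 tf uyP d'uP) (odd21_odd12 yO zO) (odd21_odd21 yP tP).
rewrite (odd12_odd12 xO zO) !addr0.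
by rewrite [LHS](ACl (1*4*16*2*5*20*7*10*15*8*11*19*3*9*14*18*6*12*13*17)).
Qed.

(** The coefficients are recovered by multiplication: E true selects the first
    row, E true and v on its right separate a, b, x there; the second row is
    moved to the first by u. *)
Lemma peirce_sum_eq0 a b c d x y :
  A11 a -> A11 b -> A11 c -> A11 d -> odd_peirce x -> odd_peirce y ->
  peirce_sum a b c d x y = 0 -> [/\ a = 0, b = 0, c = 0, d = 0 & x = 0 /\ y = 0].
Proof.
move=> aP bP cP dP [xP xv] yO sum0; have [yP _] := yO.
have [buP duP] := conj (mulP bP uP) (mulP dP uP).
have [[vcP vduP] uyP] := conj (conj (mulP vP cP) (mulP vP duP)) (skewP tf uP yP).
have row1 : a + b ** u + x = 0.
  have := congr1 (alg_mul (E true)) sum0; rewrite /peirce_sum !linearDr linear0r /=.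
  rewrite (peirce_left0 EP tf vcP) (peirce_left0 EP tf vduP) (peirce_left0 EP tf uyP).
  by rewrite aP.1 buP.1 xP.1 !addr0.
have row2 : v ** c + v ** (d ** u) + u ** y = 0.
  have := congr1 (alg_mul (E false)) sum0; rewrite /peirce_sum !linearDr linear0r /=.
  rewrite (peirce_left0 EP ft aP) (peirce_left0 EP ft buP) (peirce_left0 EP ft xP).
  by rewrite vcP.1 vduP.1 uyP.1 !add0r.
have a0 : a = 0.
  have := congr1 (alg_mul^~ (E true)) row1; rewrite !linearDl linear0l /=.
  by rewrite aP.2 (peirce_right0 EP tf buP) (peirce_right0 EP tf xP) !addr0.
have b0 : b = 0.
  have := congr1 (alg_mul^~ v) row1; rewrite a0 add0r linearDl linear0l /=.
  by rewrite xv -(ass_11_12_21 bP uP vP) uv bP.2 addr0.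
have uvc : c + d ** u = 0.
  have := congr1 (alg_mul u) row2; rewrite !linearDr linear0r /=.
  rewrite (ass_12_21_11 uP vP cP) uv cP.1.
  by have := unit_12_22 (idemP true) dP; rewrite uP.1 dP.1 uux addr0 => ->.
have c0 : c = 0.
  have := congr1 (alg_mul^~ (E true)) uvc; rewrite !linearDl linear0l /=.
  by rewrite cP.2 (peirce_right0 EP tf duP) !addr0.
have d0 : d = 0.
  have := congr1 (alg_mul^~ v) uvc; rewrite c0 add0r linear0l /=.
  by rewrite -(ass_11_12_21 dP uP vP) uv dP.2.
split=> //; split; first by move: row1; rewrite a0 b0 linear0l !add0r.
move: row2; rewrite c0 d0 linear0l !linear0r !add0r => uy0.
by rewrite -(odd_unit_mull yO) uy0 linear0r.
Qed.

(** Of p in A_12 the even part is (pv)u, and what remains is odd.  Of r in A_21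
    the even part is v(ur); the remainder w satisfies u w = 0, so it is u(vw)
    with vw odd.  Finally q in A_22 is v(uq), with uq = ((uq)v)u. *)
Lemma peirce_sum_surj z : exists a b c d x y,
  [/\ A11 a, A11 b, A11 c & A11 d] /\
  [/\ odd_peirce x, odd_peirce y & peirce_sum a b c d x y = z].
Proof.
set z11 := E true ** z ** E true; set p := E true ** z ** E false.
set r := E false ** z ** E true; set q := E false ** z ** E false.
have zE : z = z11 + p + (r + q) := peirce_decomposition EP z.
have pP : A12 p := peirce_component altA EP true false z.
have rP : A21 r := peirce_component altA EP false true z.
have qP : A22 q := peirce_component altA EP false false z.
have [pvP urP] := conj (mulP pP vP) (mulP uP rP).
pose w := r - v ** (u ** r); have wP : A21 w := peirceB rP (mulP vP urP).
have uw0 : u ** w = 0.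
  by rewrite linearBr /= (ass_12_21_11 uP vP urP) uv urP.1 subrr.
have vwP := skewP ft vP wP.
have uvw : u ** (v ** w) = w.
  have := cycle v u w; rewrite /associator uw0 vu wP.1 linear0l linear0r subr0 sub0r.
  by move=> {2}->; rewrite (anticomm ft vP wP) linearNr.
have uqP := mulP uP qP.
have uqv_u : u ** q ** v ** u = u ** q.
  have uqu : u ** q ** u = 0.
    have /subr0_eq -> : associator u q u = 0.
      by rewrite associator_swapr // (altA u q).1 oppr0.
    by rewrite (diag0 ft qP uP) linear0r.
  have := associator_swapr altA (u ** q) v u; rewrite /associator vu uv uqP.2 uqu.
  by rewrite linear0l (peirce_right0 EP tf uqP) subrr oppr0 => /subr0_eq.
exists z11, (p ** v), (u ** r), (u ** q ** v), (p - p ** v ** u), (v ** w).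
split; first by split=> //; [exact: peirce_component altA EP true true z | exact: mulP uqP vP].
split.
- split; first exact: peirceB pP (mulP pvP uP).
  by rewrite linearBl /= -(ass_11_12_21 pvP uP vP) uv pvP.2 subrr.
- split=> //; rewrite (anticomm ft vP wP) linearNl /=.
  by have /subr0_eq -> := (altA v w).2; rewrite vv linear0r oppr0.
rewrite /peirce_sum uqv_u uvw (ass_21_12_22 vP uP qP) vu qP.1 zE /w !addrA.
by rewrite [LHS](ACl (1*5*7*4*(2*6)*(3*8))) /= !subrr !addr0.
Qed.
End MatrixUnits.

(** * Coordinate spaces as kernels *)

Section Kernel.
Variables (F : fieldType) (V W : lmodType F) (f : {linear V -> W}).

Definition ker_pred : {pred V} := fun x => f x == 0.

Lemma ker_pred_submod : submod_closed ker_pred.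
Proof.
split=> [|c x y /eqP fx /eqP fy]; first by rewrite unfold_in /= linear0.
by rewrite unfold_in /= linearP fx fy scaler0 addr0.
Qed.
HB.instance Definition _ := GRing.isSubmodClosed.Build F V ker_pred ker_pred_submod.

Record kernel := Kernel { ker_val : V; ker_valP : ker_val \in ker_pred }.
HB.instance Definition _ := [isSub for ker_val].
HB.instance Definition _ := [Choice of kernel by <:].
HB.instance Definition _ := [SubChoice_isSubLmodule of kernel by <:].

Lemma ker_valD (x y : kernel) : ker_val (x + y) = ker_val x + ker_val y.
Proof. by []. Qed.
Lemma ker_valZ c (x : kernel) : ker_val (c *: x) = c *: ker_val x.
Proof. by []. Qed.
End Kernel.

(** * The coordinatizing Gamma-algebra *)

Section Coordinatization.
Variables (F : fieldType) (A : algebra F) (E : bool -> A) (u v : A).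

(** A_11 and the odd space are solution sets of linear equations; as kernels they
   inherit the structure of vector spaces over F. *)
Definition even_defect (x : A) : A * A := (E true ** x - x, x ** E true - x).
Definition odd_defect (x : A) : A * A * A :=
  (E true ** x - x, x ** E false - x, x ** v).

Lemma even_defect_linear : linear even_defect.
Proof.
move=> c x y; rewrite /even_defect linearPr linearPl /=.
by congr (_, _); rewrite /= scalerBr opprD addrACA.
Qed.
HB.instance Definition _ := GRing.isLinear.Build F _ _ _ even_defect even_defect_linear.

Lemma odd_defect_linear : linear odd_defect.
Proof.
move=> c x y; rewrite /odd_defect linearPr !linearPl /=.
by congr (_, _, _); rewrite /= scalerBr opprD addrACA.
Qed.
HB.instance Definition _ := GRing.isLinear.Build F _ _ _ odd_defect odd_defect_linear.

Definition coord_even := kernel even_defect.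
Definition coord_odd := kernel odd_defect.
HB.instance Definition _ := GRing.Lmodule.on coord_even.
HB.instance Definition _ := GRing.Lmodule.on coord_odd.

Lemma even_defectP x : peirce E true true x <-> x \in ker_pred even_defect.
Proof.
rewrite unfold_in; split=> [[h1 h2]|/eqP[/subr0_eq h1 /subr0_eq h2]] //.
by rewrite /= /even_defect h1 h2 subrr.
Qed.
Lemma odd_defectP x : odd_peirce E v x <-> x \in ker_pred odd_defect.
Proof.
rewrite unfold_in; split=> [[[h1 h2] h3]|/eqP[/subr0_eq h1 /subr0_eq h2 h3]] //.
by rewrite /= /odd_defect h1 h2 h3 !subrr.
Qed.

Hypothesis altA : alternative_algebra A.
Hypothesis EP : complementary_idempotents E.
Hypotheses (uP : peirce E true false u) (vP : peirce E false true v).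
Hypotheses (uv : u ** v = E true) (vu : v ** u = E false).

Let tf : true != false. Proof. by []. Qed.
Let evenP (a : coord_even) : peirce E true true (ker_val a).
Proof. exact/even_defectP/ker_valP. Qed.
Let oddP (x : coord_odd) : odd_peirce E v (ker_val x).
Proof. exact/odd_defectP/ker_valP. Qed.

Fact coord_mul00_subproof (a b : coord_even) : ker_val a ** ker_val b \in ker_pred even_defect.
Proof. exact/even_defectP/(peirce_mul altA EP (evenP a) (evenP b)). Qed.
Definition coord_mul00 (a b : coord_even) : coord_even := Kernel (coord_mul00_subproof a b).

Fact coord_mul01_subproof (a : coord_even) (x : coord_odd) :
  ker_val a ** ker_val x \in ker_pred odd_defect.
Proof. exact/odd_defectP/(odd_mull altA EP vP (evenP a) (oddP x)). Qed.
Definition coord_mul01 (a : coord_even) (x : coord_odd) : coord_odd :=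
  Kernel (coord_mul01_subproof a x).
Definition coord_mul10 (x : coord_odd) (a : coord_even) := coord_mul01 a x.

Fact coord_mul11_subproof (x y : coord_odd) :
  u ** (ker_val x ** ker_val y) \in ker_pred even_defect.
Proof.
apply/even_defectP/(peirce_mul altA EP uP).
exact: (peirce_skew altA EP tf (oddP x).1 (oddP y).1).
Qed.
(** In the matrix model m_1 m_1 = e_21, so xy is <x,y> placed in A_21, and u moves
    it to A_11. *)
Definition coord_mul11 (x y : coord_odd) : coord_even :=
  Kernel (coord_mul11_subproof x y).

Lemma coord_mul00_bilinear : bilinear_for *:%R *:%R coord_mul00.
Proof.
by split=> [b c a a'|a c b b']; apply: val_inj; rewrite /= (linearPl, linearPr).
Qed.
HB.instance Definition _ := bilinear_isBilinear.Build F _ _ _ *:%R *:%R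
  coord_mul00 coord_mul00_bilinear.
Lemma coord_mul01_bilinear : bilinear_for *:%R *:%R coord_mul01.
Proof.
by split=> [b c a a'|a c b b']; apply: val_inj; rewrite /= (linearPl, linearPr).
Qed.
HB.instance Definition _ := bilinear_isBilinear.Build F _ _ _ *:%R *:%R
  coord_mul01 coord_mul01_bilinear.
Lemma coord_mul10_bilinear : bilinear_for *:%R *:%R coord_mul10.
Proof.
by split=> [b c a a'|a c b b']; apply: val_inj; rewrite /= (linearPl, linearPr).
Qed.
HB.instance Definition _ := bilinear_isBilinear.Build F _ _ _ *:%R *:%R
  coord_mul10 coord_mul10_bilinear.
Lemma coord_mul11_bilinear : bilinear_for *:%R *:%R coord_mul11.
Proof.
by split=> [b c a a'|a c b b']; apply: val_inj; rewrite /= (linearPl, linearPr) linearPr.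
Qed.
HB.instance Definition _ := bilinear_isBilinear.Build F _ _ _ *:%R *:%R
  coord_mul11 coord_mul11_bilinear.

Definition coord_graded : graded_algebra F :=
  GradedAlgebra coord_mul00 coord_mul01 coord_mul10 coord_mul11.

Lemma coord_laws : Gamma_laws coord_graded.
Proof.
split.
- have eP : E true \in ker_pred even_defect by apply/even_defectP; split; apply: EP.2.
  exists (Kernel eP : coord_even); split=> [a|x].
    by have [h1 h2] := evenP a; split; apply: val_inj.
  by apply: val_inj; have [[]] := oddP x.
- move=> a b c; apply: val_inj.
  exact: (peirce11_assoc altA EP uP vP uv (evenP a) (evenP b) (evenP c)).
- by move=> a x; apply: val_inj.
- move=> a b x; apply: val_inj.
  have aP := evenP a; have bP := evenP b; have xO := oddP x.
  rewrite /= (odd_mulC altA EP uP vP vu aP bP xO); apply/esym/associator0.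
  exact: (peirce_ass_iij altA EP tf bP aP xO.1).
- move=> a b x; apply: val_inj.
  have aP := evenP a; have bP := evenP b; have xO := oddP x.
  have ass c d : peirce E true true c -> peirce E true true d ->
      c ** (d ** ker_val x) = c ** d ** ker_val x.
    by move=> cP dP; apply/associator0/(peirce_ass_iij altA EP tf cP dP xO.1).
  by rewrite /= !ass // (odd_mulC altA EP uP vP vu aP bP xO).
- move=> a x y; apply: val_inj.
  exact: (unit_form_mull altA EP uP (evenP a) (oddP x).1 (oddP y).1).
- move=> a x y; apply: val_inj; have aP := evenP a.
  have [xP _] := oddP x; have [yP _] := oddP y.
  rewrite /= -(unit_form_mull altA EP uP aP xP yP).
  exact/esym/(unit_form_mulr altA EP uP aP xP yP).
- move=> x; apply: val_inj; have [xP _] := oddP x.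
  by rewrite /= (peirce_square0 altA EP tf xP) linear0r.
- move=> x y z; apply: val_inj.
  exact: (odd_cyclic altA EP uP vP uv vu (oddP x) (oddP y) (oddP z)).
Qed.

Definition coord_sum (X : M2G coord_graded) : A :=
  peirce_sum u v (ker_val (X.1 0 0 : coord_even)) (ker_val (X.1 0 1 : coord_even))
    (ker_val (X.1 1 0 : coord_even)) (ker_val (X.1 1 1 : coord_even))
    (ker_val (X.2.1 : coord_odd)) (ker_val (X.2.2 : coord_odd)).

Lemma coord_sum_linear : linear coord_sum.
Proof.
move=> k X Y; rewrite /coord_sum /peirce_sum !mxE !ker_valD !ker_valZ.
rewrite !(linearDl, linearDr, linearZl_LR, linearZr_LR) !scalerDr /= !addrA.
by rewrite [RHS](ACl (1*7*2*8*3*9*4*10*5*11*6*12)).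
Qed.

Lemma coord_sum_hom : {morph coord_sum : X Y / X ** Y}.
Proof.
move=> [P [x y]] [Q [z t]]; rewrite /coord_sum.
rewrite (peirce_sum_mul altA EP uP vP uv vu) //.
congr peirce_sum; rewrite /= /mat2_entry !mxE /= ?sum2E //.
  by rewrite linearNl.
by rewrite linearNl.
Qed.

HB.instance Definition _ := GRing.isLinear.Build F _ _ _ coord_sum coord_sum_linear.

Lemma coord_sum_bij : bijective coord_sum.
Proof.
apply: linear_bijective => [[P [x y]] PXY0|z].
  have := peirce_sum_eq0 altA EP uP vP uv vu (evenP (P 0 0)) (evenP (P 0 1))
    (evenP (P 1 0)) (evenP (P 1 1)) (oddP x) (oddP y) PXY0.
  case=> a0 b0 c0 d0 [x0 y0]; congr (_, (_, _)); try exact: val_inj.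
  by apply: mat2P; rewrite mxE; apply: val_inj.
have [a [b [c [d [x [y [[aP bP cP dP] [xO yO <-]]]]]]]] :=
  peirce_sum_surj altA EP uP vP uv vu z.
move: aP bP cP dP xO yO => /even_defectP aP /even_defectP bP /even_defectP cP.
move=> /even_defectP dP /odd_defectP xO /odd_defectP yO.
exists (mx22 (Kernel aP : coord_even) (Kernel bP) (Kernel cP) (Kernel dP),
  (Kernel xO : coord_odd, Kernel yO : coord_odd)).
by rewrite /= /coord_sum !mxE.
Qed.

Lemma coord_iso : alg_isomorphic (M2G coord_graded) A.
Proof.
by exists coord_sum; split; [exact: coord_sum_bij | exact: coord_sum_hom].
Qed.
End Coordinatization.

(** The images of the matrix units need not be linearly independent: they are all
    0 when A = 0, and then so is G. *)
Theorem M2_coordinatization (F : fieldType) (A : algebra F) :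
  alternative_M2_algebra A ->
  exists G : graded_algebra F, Gamma_algebra G /\ alg_isomorphic (M2G G) A.
Proof.
move=> [altA [e [eP [f [fM f1]]]]].
pose m i j : M2_algebra F := (delta_mx i j : 'M[F]_2).
have fm i j k l : f (m i j) ** f (m k l) = if j == k then f (m i l) else 0.
  rewrite -fM /m [_ ** _]mul_delta_mx_cond.
  by case: eqP; rewrite ?mulr1n // mulr0n linear0.
pose E b := if b then f (m 0 0) else f (m 1 1).
have EP : complementary_idempotents E.
  split; last by case; rewrite /E fm eqxx.
  suff -> : E true + E false = e by [].
  rewrite -f1 -linearD; congr (f _); apply: mat2P; rewrite !mxE /= ?addr0 ?add0r //.
have uP : peirce E true false (f (m 0 1)) by split; rewrite fm eqxx.
have vP : peirce E false true (f (m 1 0)) by split; rewrite fm eqxx.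
have uv : f (m 0 1) ** f (m 1 0) = E true by rewrite fm eqxx.
have vu : f (m 1 0) ** f (m 0 1) = E false by rewrite fm eqxx.
exists (coord_graded altA EP uP vP); split; last exact: (coord_iso altA EP uP vP uv vu).
exact/Gamma_algebraP/(coord_laws altA EP uP vP uv vu).
Qed.

Theorem theorem3 (F : fieldType) :
  (forall G : graded_algebra F, Gamma_algebra G ->
     alg_isomorphic (envelope G (B42 F)) (M2G G)) /\
  (forall A : algebra F,
     alternative_M2_algebra A <->
     exists G : graded_algebra F,
       Gamma_algebra G /\ alg_isomorphic A (envelope G (B42 F))).
Proof.
have iso (G : graded_algebra F) :
    Gamma_algebra G -> alg_isomorphic (envelope G (B42 F)) (M2G G).
  by move=> /Gamma_algebraP laws; apply/envelope_iso/(Gamma_mulC laws).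
split=> // A; split=> [/M2_coordinatization[G [GG MA]]|[G [GG AG]]].
  exists G; split=> //.
  exact: alg_iso_trans (alg_iso_sym MA) (alg_iso_sym (iso G GG)).
apply: (alternative_M2_algebra_iso (alg_iso_sym (alg_iso_trans AG (iso G GG)))).
exact/M2G_alternative_M2_algebra/Gamma_algebraP.
Qed.
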